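(* Let $f=g\circ h$ be irreducible, where $g,h\in\mathbb{Z}[x]$, $\deg g=r$, $\deg h=s$, $\deg f=d=rs$, and $r,s\ge 2$. Then, as $N\to\infty$ with $f$ fixed, $$\log L_f(N)\gtrsim \frac{d-1}{d-r}\,N\log N.$$
   Context: For an irreducible polynomial $f\in\mathbb{Z}[x]$ of degree at least $2$ and a positive integer $N$, let $L_f(N)=\mathrm{lcm}(f(1),f(2),\ldots,f(N))$. In all asymptotic notation $f$ is fixed and $N\to\infty$. For functions $A,B$ with $B(N)>0$ for all large $N$, $A(N)\gtrsim B(N)$ means $\liminf_{N\to\infty}A(N)/B(N)\ge 1$. *)

(* Defs.v *)
From HB Require Import structures.
From mathcomp Require Import all_boot all_order all_algebra.
From mathcomp Require Import all_classical all_reals all_analysis.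

Set Implicit Arguments.
Unset Strict Implicit.
Unset Printing Implicit Defensive.

Import Order.TTheory GRing.Theory Num.Theory.

Local Open Scope ring_scope.

(* The lcm of integers is taken nonnegative, hence computed on absolute values
   (as in [lcmz]). *)
Definition poly_lcm (f : {poly int}) (N : nat) : nat :=
  \big[lcmn/1%N]_(1 <= n < N.+1) `|f.[n%:Z]|%N.

(* liminf A(N)/B(N) >= 1, the liminf being taken in the extended reals; only
   meaningful for B eventually positive, since x / 0 = 0. *)
Definition asymp_ge (R : realType) (A B : nat -> R) : Prop :=
  (1%:E <= limn_einf (fun N => (A N / B N)%:E))%E.

(* [irreducible_poly] below is used for polynomials over int. There [%|] is
   pseudo-divisibility (q %| p iff q divides c *: p for some nonzero integer c),
   i.e. divisibility over the rationals, so [irreducible_poly f] says that f has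
   positive degree and is not a product of two nonconstant polynomials; a
   nontrivial content is allowed. *)

(* Main.v *)
Require Import Defs.
From mathcomp Require Import all_boot all_order all_fingroup all_algebra.
From mathcomp Require Import all_classical all_reals all_analysis.
From mathcomp Require Import zify ring lra.

(** Write f = g o h, P(N) = |f(1) ... f(N)| and L(N) = lcm(f(1), ..., f(N)).
    The logarithm of P(N) is at least d N log N - O(N) ([sum_ln_horner_ge]), and
    the prime factors of P(N) are split at K N, for a large constant K.

    - A prime p > K N divides f(n) for at most r (s - 1) = d - r integers n in
      [1, N] ([large_prime_roots]).  Indeed g has at most r roots y modulo p.  If
      some equation h(n) = y modulo p had s solutions n_1, ..., n_s in [1, N], the
      sum of the roots of h - y would show that p divides
      h_s (n_1 + ... + n_s) + h_{s-1}.  This integer is smaller than p in absolute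
      value, hence it is 0, so the n_i are bounded; but then p divides a nonzero
      f(n_1) which is too small.  Therefore v_p(P(N)) <= (d - r) v_p(L(N)), and
      these primes contribute at most (d - r) log L(N) to log P(N).

    - The primes p <= K N contribute at most (1 + eps) N log N + O(N)
      ([small_primes_bound]).  With rho(p) the number of roots of f modulo p, the
      valuation of P(N) at all but finitely many p is at most
      rho(p) (N / (p - 1) + O(log N / log p)).  The second term is negligible
      because the primes have density zero, and the first one is controlled by the
      bound sum_{p <= X} rho(p) log p / p <= (1 + eps) log X + O(1)
      ([root_sum_le]).

    Comparing the two gives (d - r) log L(N) >= (d - 1 - eps) N log N - O(N).

    The bound on the sum of rho(p) log p / p is the upper half of the prime ideal
    theorem in the form of Mertens.  It is obtained here by a lattice point count
    instead of a count of ideals.  One may assume that f is monic, replacing it by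
    c^(d-1) f(x / c) with c its leading coefficient.  Let M be the companion
    matrix of f.  An integer vector w, seen as an element of Z[x] / (f), has as
    norm the determinant of the matrix with rows w M^i, 0 <= i < d.  It is nonzero
    for w <> 0, because f is irreducible, and it is O(H^d) when w has entries in
    [0, H).  If t is a root of f modulo p, the w which vanish at t modulo p form a
    lattice of index p, stable under M.  By the pigeonhole principle it has a
    nonzero vector of size p^(1/d), and the images of this vector under the powers
    of M are d independent vectors of the lattice of size O(p^(1/d)).  Hence every
    class modulo the lattice has a representative of size O(p^(1/d))
    ([lattice_cover]), and the box [0, H)^d contains nearly H^d / p vectors of the
    lattice as soon as H is a large multiple of p^(1/d) ([lattice_count]).  If w
    lies in the lattices of k distinct roots modulo p, then p^k divides its norm
    ([card_roots_le_logn]).  Summing the logarithm of the norm over the box thus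
    bounds H^d sum_p rho(p) log p / p, where p <= X = (H / const)^d, essentially by
    H^d d log H, that is by H^d (log X + O(1)) ([landau_ineq]). *)

Set Implicit Arguments.
Unset Strict Implicit.
Unset Printing Implicit Defensive.

Import Order.TTheory GRing.Theory Num.Theory.

Local Open Scope ring_scope.

(** * Matrices of multiplication by an algebraic integer *)

(** The column (1, t, ..., t^(n-1)): a row vector times this column is the value
    at t of the polynomial of which it lists the coefficients. *)
Definition powcol n (t : int) : 'cV[int]_n := \col_i t ^+ i.

(** For the companion matrix of F, the column of powers of t is an eigenvector up
    to a multiple of F(t). *)
Lemma companion_powcol (n : nat) (F : {poly int}) :
  F \is monic -> size F = n.+2 ->
  exists M : 'M[int]_n.+1, horner_mx M F = 0 /\
    forall t, M *m powcol n.+1 t = t *: powcol n.+1 t - F.[t] *: delta_mx ord_max 0.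
Proof.
move=> Fmon sF.
have [M [cpM ME]] : exists M : 'M[int]_n.+1, char_poly M = F /\
    M = \matrix_(i, j) if i == n :> nat then - F`_j else (i.+1 == j :> nat)%:R.
  have := companionmxK Fmon; rewrite /companionmx sF /= => H.
  by eexists; split; [exact: H|].
exists M; split; first by rewrite -cpM Cayley_Hamilton.
move=> t; apply/colP => i; rewrite ME !mxE.
under eq_bigr do rewrite !mxE.
have [iM|iM] := eqVneq (i : nat) n.
  have -> : i == ord_max by apply/eqP/val_inj.
  have /eqP HH := Fmon; rewrite lead_coefE sF /= in HH.
  rewrite /= mulr1 -exprS iM horner_coef sF [in RHS]big_ord_recr /= HH.
  rewrite mul1r opprD addrCA subrr addr0 -sumrN.
  by apply: eq_bigr => j _; rewrite mulNr.
have iM' : (i == ord_max) = false by apply: contraNF iM => /eqP ->.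
rewrite iM' /= mulr0 subr0 -exprS.
have ilt : (i.+1 < n.+1)%N by have := ltn_ord i; lia.
rewrite (bigD1 (Ordinal ilt)) //= eqxx mul1r big1 ?addr0 // => j.
rewrite -val_eqE /= eq_sym => /negPf ->; by rewrite mul0r.
Qed.

(** The matrix with rows w M^i.  When M is the companion matrix of F, it is the
    matrix of the multiplication by w in Z[x] / (F), and its determinant is the
    norm of w. *)
Definition orbitmx n (M : 'M[int]_n.+1) (w : 'rV[int]_n.+1) : 'M[int]_n.+1 :=
  \matrix_i (w *m M ^+ i).

Lemma mul_orbitmx n (M : 'M[int]_n.+1) (w z : 'rV[int]_n.+1) :
  z *m orbitmx M w = w *m horner_mx M (rVpoly z).
Proof.
rewrite mulmx_sum_row.
have -> : rVpoly z = \sum_i z 0 i *: 'X^i.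
  rewrite /rVpoly poly_def; apply: eq_bigr => i _.
  by rewrite valK.
rewrite rmorph_sum /= mulmx_sumr; apply: eq_bigr => i _.
by rewrite rowK horner_mxZ rmorphXn /= horner_mx_X scalemxAr.
Qed.

(** If w vanishes at t modulo p and t is an eigenvalue of M modulo p, then all the
    w M^i vanish at t modulo p. *)
Lemma orbitmx_powcol n (M : 'M[int]_n.+1) (w : 'rV[int]_n.+1) (p t : int) :
  (forall i, (p %| ((M *m powcol n.+1 t - t *: powcol n.+1 t) i 0)%R)%Z) ->
  (p %| ((w *m powcol n.+1 t) 0 0)%R)%Z ->
  forall i, (p %| ((orbitmx M w *m powcol n.+1 t) i 0)%R)%Z.
Proof.
set v := powcol _ _ => HM Hw i.
have -> : (orbitmx M w *m v) i 0 = (w *m M ^+ i *m v) 0 0.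
  by rewrite -(rowK (fun i : 'I_n.+1 => w *m M ^+ i) i) -row_mul [RHS]mxE.
elim: {i}(i : nat) => [|k IH]; first by rewrite expr0 mulmx1.
rewrite exprSr mulmxA -(mulmxA _ M v).
have -> : M *m v = (M *m v - t *: v) + t *: v by rewrite subrK.
rewrite mulmxDr mxE rpredD //.
  by rewrite mxE rpred_sum // => j _; rewrite dvdz_mull.
by rewrite -scalemxAr mxE dvdz_mull.
Qed.

(** A dependence z between the rows w M^i would give w z(M) = 0, although z(M) is
    invertible over the rationals, z being coprime to F. *)
Lemma det_orbitmx_neq0 n (F : {poly int}) (M : 'M[int]_n.+1) (w : 'rV[int]_n.+1) :
  irreducible_poly F -> size F = n.+2 -> horner_mx M F = 0 -> w != 0 ->
  \det (orbitmx M w) != 0.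
Proof.
move=> Firr sF HF w0; apply/negP => /det0P[z z0 zW].
have Pz0 : rVpoly z != 0.
  by apply: contraNneq z0 => Pz0; rewrite -(rVpolyK z) Pz0 linear0.
have sP : (size (rVpoly z) <= n.+1)%N by exact: size_poly.
have [_ Firr2] := Firr.
have cop : coprimep F (rVpoly z).
  rewrite /coprimep; apply/negPn/negP => /Firr2 /(_ (dvdp_gcdl _ _)) /eqp_size sg.
  have := dvdp_leq Pz0 (dvdp_gcdr F (rVpoly z)); rewrite sg sF; lia.
have /Bezout_coprimepP[[u v] /= /eqpP[[c1 c2] /= /andP[c10 c20]]] := cop.
move=> E.
have := congr1 (horner_mx M) E.
rewrite !horner_mxZ rmorphD !rmorphM /= HF mulr0 add0r rmorph1 => /(congr1 (mulmx w)).
have comm : horner_mx M v * horner_mx M (rVpoly z) = horner_mx M (rVpoly z) * horner_mx M v.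
  by rewrite -!rmorphM mulrC.
rewrite comm -scalemxAr mulmxA -mul_orbitmx zW mul0mx scaler0 => /esym/eqP.
by rewrite -scalemxAr mulmx1 scalemx_eq0 (negPf c20) (negPf w0).
Qed.

(** A square matrix which kills modulo p the columns of powers of k distinct
    residues has a determinant divisible by p^k. *)
Lemma prime_pow_dvd_det n (W : 'M[int]_n) (p : nat) (s : seq nat) :
  prime p -> uniq s -> all (fun t => t < p)%N s -> (size s <= n)%N ->
  (forall t, t \in s -> forall i, (p%:Z %| ((W *m powcol n t%:Z) i 0)%R)%Z) ->
  (p ^ size s %| `|\det W|)%N.
Proof.
move=> pp us sp sn.
move: (subnKC sn) => En; move: W; rewrite -En; move: (n - size s)%N => l.
set k := size s => W HW {sn En}.
pose a : 'rV[int]_k := \row_j (nth 0%N s j)%:Z.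
pose B : 'M[int]_(k + l, k) := \matrix_(i, j) (nth 0%N s j)%:Z ^+ i.
(* The columns of powers, completed by unit columns: the determinant of V is that
   of Vandermonde, hence prime to p, and the first k columns of W V are divisible
   by p. *)
pose V := block_mx (usubmx B) 0 (dsubmx B) 1%:M.
have detV : \det V = \det (Vandermonde k a).
  rewrite det_lblock det1 mulr1; congr (\det _).
  by apply/matrixP => i j; rewrite !mxE.
have pV : ~~ (p%:Z %| \det V)%Z.
  rewrite detV det_Vandermonde dvdzE (big_morph absz abszM (erefl _)) /=.
  rewrite Euclid_dvd_prod //; apply/negP; rewrite big_has => /hasP[i _].
  rewrite (big_morph absz abszM (erefl _)) Euclid_dvd_prod //.
  rewrite big_has_cond => /hasP[j _] /andP[ij].
  rewrite !mxE => pij.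
  have si := allP sp _ (mem_nth 0%N (ltn_ord i)).
  have sj := allP sp _ (mem_nth 0%N (ltn_ord j)).
  have ne : nth 0%N s j != nth 0%N s i.
    by rewrite nth_uniq // neq_ltn ij orbT.
  move: (nth _ _ j) (nth _ _ i) si sj ne pij => x y xp yp xy pxy.
  have x0 : (0 < `|(x%:Z - y%:Z)%R|)%N by lia.
  by have := dvdn_leq x0 pxy; lia.
pose Q : 'M[int]_(k + l, k) := \matrix_(i, j) ((W *m B) i j %/ p%:Z)%Z.
have WB : W *m B = p%:Z *: Q.
  apply/matrixP => i j; rewrite [RHS]mxE [Q i j]mxE [RHS]mulrC divzK //.
  have := HW (nth 0%N s j) (mem_nth 0%N (ltn_ord j)) i.
  by congr (_ %| _)%Z; rewrite !mxE; apply: eq_bigr => x _; rewrite !mxE.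
have WV : W *m V = row_mx Q (W *m col_mx 0 1%:M) *m block_mx (p%:Z)%:M 0 0 1%:M.
  rewrite /V block_mxEh mul_mx_row vsubmxK WB.
  by rewrite mul_row_block !mulmx0 mulmx1 add0r addr0 mul_mx_scalar.
have : (p%:Z ^+ k %| \det W * \det V)%Z.
  by rewrite -det_mulmx WV det_mulmx det_ublock det_scalar det1 mulr1 dvdz_mull.
rewrite Gauss_dvdzl; last first.
  by rewrite coprimezXl // coprimezE /= prime_coprime // -dvdzE.
by rewrite /dvdz abszX.
Qed.

(** * Ideal lattices in boxes *)

(** A point of the box [0, H)^n, seen as an integer row vector. *)
Definition boxvec n H (a : {ffun 'I_n -> 'I_H}) : 'rV[int]_n := \row_j (a j : nat)%:Z.

(** The value at t modulo p of the polynomial with coefficients w.  The lattice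
    of the residue t is the kernel of this map. *)
Definition evalmod n (p t : nat) (w : 'rV[int]_n) : 'F_p :=
  ((w *m powcol n t%:Z) 0 0)%:~R.

Lemma evalmodD n p t (w1 w2 : 'rV[int]_n) :
  evalmod p t (w1 + w2) = evalmod p t w1 + evalmod p t w2.
Proof. by rewrite /evalmod mulmxDl mxE intrD. Qed.

Lemma evalmodN n p t (w : 'rV[int]_n) : evalmod p t (- w) = - evalmod p t w.
Proof. by rewrite /evalmod mulNmx mxE intrN. Qed.

Lemma Fp_intr_eq0 (p : nat) (z : int) : prime p -> ((z%:~R : 'F_p) == 0) = (p%:Z %| z)%Z.
Proof. by move=> pp; rewrite -(dvdz_pcharf (pchar_Fp pp)). Qed.

Lemma evalmod_eq0 n p t (w : 'rV[int]_n) : prime p ->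
  (evalmod p t w == 0) = (p%:Z %| ((w *m powcol n t%:Z) 0 0)%R)%Z.
Proof. by move=> pp; rewrite Fp_intr_eq0. Qed.

(** Pigeonhole: two of the more than p points of the box [0, m]^n have the same
    value at t modulo p, and their difference is a short vector of the lattice. *)
Lemma short_vector n (p t m : nat) : prime p -> (p < m.+1 ^ n)%N ->
  exists w : 'rV[int]_n, [/\ w != 0, forall j, `|w 0 j| <= m%:Z & evalmod p t w == 0].
Proof.
move=> pp pm.
pose f (a : {ffun 'I_n -> 'I_m.+1}) := evalmod p t (boxvec a).
have /injectivePn[a [b ab fab]] : ~~ injectiveb f.
  apply/negP => /injectiveP /leq_card; rewrite card_ffun !card_ord Fp_cast //; lia.
exists (boxvec a - boxvec b); split.
- apply: contraNneq ab => /eqP; rewrite subr_eq0 => /eqP E.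
  apply/eqP/ffunP => j; apply/val_inj => /=.
  have := congr1 (fun v : 'rV_n => v 0 j) E.
  by rewrite !mxE => -[].
- move=> j; rewrite !mxE; move: (ltn_ord (a j)) (ltn_ord (b j)).
  by move: (nat_of_ord _) (nat_of_ord _) => x y; lia.
- by rewrite evalmodD evalmodN -/(f a) -/(f b) fab subrr.
Qed.

Lemma orbitmx_bound n (M : 'M[int]_n.+1) : exists C : nat,
  forall (w : 'rV[int]_n.+1) (m : nat), (forall j, `|w 0 j| <= m%:Z) ->
  forall i j, `|orbitmx M w i j| <= (C * m)%N%:Z.
Proof.
pose C : nat := (\sum_(i < n.+1) \sum_(j < n.+1) \sum_(k < n.+1) `|((M ^+ i) k j)%R|)%N.
exists C => w m wm i j; rewrite mxE mxE.
apply: le_trans (ler_norm_sum _ _ _) _.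
have H : (\sum_(k < n.+1) `|((M ^+ i) k j)%R| <= C)%N.
  rewrite /C [leqRHS](bigD1 i) //=; apply: leq_trans (leq_addr _ _).
  by rewrite [leqRHS](bigD1 j) //= leq_addr.
apply: (@le_trans _ _ (\sum_(k < n.+1) (`|((M ^+ i) k j)%R| * m)%N%:Z)).
  by apply: ler_sum => k _; rewrite normrM mulrC PoszM abszE ler_wpM2l.
by rewrite -(big_morph Posz PoszD (erefl _)) lez_nat -big_distrl leq_mul2r H orbT.
Qed.

(** When t is a root of F modulo p and p <= m^(n+1), every class modulo the
    lattice of t has a representative in a box of side O(m), uniformly in p and
    t. *)
Lemma lattice_cover n (F : {poly int}) (M : 'M[int]_n.+1) :
  irreducible_poly F -> size F = n.+2 -> horner_mx M F = 0 ->
  (forall t, M *m powcol n.+1 t = t *: powcol n.+1 t - F.[t] *: delta_mx ord_max 0) ->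
  exists C : nat, forall p t m : nat, prime p -> (p%:Z %| F.[t%:Z])%Z ->
    (p <= m ^ n.+1)%N ->
  forall v : 'rV[int]_n.+1, exists u : 'rV[int]_n.+1,
    evalmod p t u = evalmod p t v /\ forall j, 0 <= u 0 j <= (C * m)%N%:Z.
Proof.
move=> Firr sF HF HM.
have [C0 HC0] := orbitmx_bound M.
exists (2 * (n.+1 * C0))%N => p t m pp pF pm v.
have pm1 : (p < m.+1 ^ n.+1)%N by apply: leq_ltn_trans pm _; rewrite ltn_exp2r.
have [w [w0 wm wL]] := short_vector t pp pm1.
set W := orbitmx M w.
have D0 : \det W != 0 by exact: det_orbitmx_neq0 HF w0.
have WL z : evalmod p t (z *m W) = 0.
  apply/eqP; rewrite evalmod_eq0 // -mulmxA mxE rpred_sum // => i _.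
  apply: dvdz_mull; apply: orbitmx_powcol.
  - move=> k; rewrite HM.
    have -> : t%:Z *: powcol n.+1 t - F.[t%:Z] *: delta_mx ord_max 0 - t%:Z *: powcol n.+1 t
      = - (F.[t%:Z] *: delta_mx ord_max 0) by rewrite addrAC subrr add0r.
    by rewrite !mxE rpredN dvdz_mulr.
  - by rewrite -evalmod_eq0.
have Wb := HC0 w m wm; rewrite -/W in Wb.
(* The vector v - c is reduced modulo the rows of W, its rational coordinates
   y / D being rounded down.  Starting from v - c rather than v makes the entries
   of the representative u nonnegative. *)
pose E := (n.+1 * C0 * m)%N.
pose c : 'rV[int]_n.+1 := const_mx E%:Z.
set D := \det W in D0.
pose y := (v - c) *m \adj W.
pose q : 'rV[int]_n.+1 := \row_i (y 0%R i %/ D)%Z.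
pose r : 'rV[int]_n.+1 := \row_i (y 0%R i %% D)%Z.
have yE : y = D *: q + r.
  by apply/rowP => i; rewrite !mxE mulrC -divz_eq.
pose u := v - q *m W.
exists u; split; first by rewrite /u evalmodD evalmodN WL subr0.
have DE : D *: (u - c) = r *m W.
  have H : y *m W = D *: (v - c) by rewrite /y -mulmxA mul_adj_mx mul_mx_scalar.
  by rewrite /u addrAC scalerBr -H yE mulmxDl -scalemxAl addrAC subrr add0r.
move=> j.
suff : `|u 0 j - E%:Z| <= E%:Z.
  have -> : (2 * (n.+1 * C0) * m = E + E)%N by rewrite /E; lia.
  have aux (x : int) (z : nat) : `|x - z%:Z| <= z%:Z -> 0 <= x <= (z + z)%N%:Z by lia.
  exact: aux.
have Dp : 0 < `|D| by rewrite normr_gt0.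
rewrite -(ler_pM2l Dp) -normrM.
have -> : D * (u 0 j - E%:Z) = (r *m W) 0 j by rewrite -DE !mxE.
rewrite mxE; apply: le_trans (ler_norm_sum _ _ _) _.
apply: (@le_trans _ _ (\sum_(k < n.+1) `|D| * (C0 * m)%N%:Z)).
  apply: ler_sum => k _; rewrite normrM ler_pM // mxE.
  by rewrite ger0_norm ?modz_ge0 // ltW // ltz_mod.
by rewrite sumr_const card_ord -mulrnAr /E -mulnA [in leRHS]PoszM -[n.+1%:Z]natz mulr_natl.
Qed.

(** Each of the p classes of points of the box of side H is translated into the
    lattice, inside the box of side H + E. *)
Lemma lattice_count n (p t H E : nat) :
  prime p ->
  (forall v : 'rV[int]_n.+1, exists u : 'rV[int]_n.+1,
    evalmod p t u = evalmod p t v /\ forall j, 0 <= u 0 j <= E%:Z) ->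
  (H ^ n.+1 <=
   p * #|[pred a : {ffun 'I_n.+1 -> 'I_(H + E)} | (evalmod p t (boxvec a) == 0)%R]|)%N.
Proof.
move=> pp cover.
set L := #|_|.
pose f (a : {ffun 'I_n.+1 -> 'I_H}) := evalmod p t (boxvec a).
have -> : (H ^ n.+1 = \sum_(y : 'F_p) #|[pred a | f a == y]|)%N.
  rewrite -[in LHS](card_ord H) -[X in (_ ^ X)%N](card_ord n.+1) -card_ffun -sum1_card.
  rewrite (partition_big f predT) //=; apply: eq_bigr => y _.
  by rewrite -sum1_card.
have -> : (p * L = \sum_(y : 'F_p) L)%N by rewrite sum_nat_const card_Fp.
apply: leq_sum => y _.
(* The vector v0 takes the value - y, so its small representative u translates
   the class of y into the lattice. *)
pose v0 : 'rV[int]_n.+1 := \row_j (if j == 0 then - (y : nat)%:Z else 0).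
have fv0 : evalmod p t v0 = - y.
  rewrite /evalmod mxE (bigD1 0) //= big1 ?addr0 => [|i /negPf i0]; last first.
    by rewrite !mxE i0 mul0r.
  rewrite !mxE eqxx expr0 mulr1 intrN; congr (- _).
  exact: natr_Zp.
have [u [fu ub]] := cover v0.
have lt (a : {ffun 'I_n.+1 -> 'I_H}) j : (a j + `|u 0%R j| < H + E)%N.
  by have := ub j; have := ltn_ord (a j); lia.
pose g a : {ffun 'I_n.+1 -> 'I_(H + E)} := [ffun j => Ordinal (lt a j)].
have gE a : boxvec (g a) = boxvec a + u.
  by apply/rowP => j; rewrite !mxE ffunE /= PoszD; have := ub j; lia.
have ginj : injective g.
  move=> a b /ffunP ab; apply/ffunP => j; apply/val_inj.
  have := congr1 val (ab j); rewrite !ffunE /=; lia.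
rewrite -(card_imset _ ginj); apply: subset_leq_card.
apply/fintype.subsetP => _ /imsetP[a /eqP fa ->].
by rewrite inE gE evalmodD fu fv0 -/(f a) fa subrr.
Qed.

(** * Size and divisibility of norms *)

Lemma det_bound n (W : 'M[int]_n) (B : nat) :
  (forall i j, `|W i j| <= B%:Z) -> (`|\det W| <= n`! * B ^ n)%N.
Proof.
move=> HW; rewrite -lez_nat abszE.
apply: le_trans (ler_norm_sum _ _ _) _.
apply: (@le_trans _ _ (\sum_(s : 'S_n) (B ^ n)%N%:Z)).
  apply: ler_sum => s _; rewrite normrM normrX normrN1 expr1n mul1r normr_prod.
  have -> : (B ^ n)%N%:Z = \prod_(i < n) B%:Z by rewrite prodr_const card_ord -natz natrX natz.
  by apply: ler_prod => i _; rewrite normr_ge0 HW.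
by rewrite sumr_const card_Sn PoszM -[(n`!)%:Z]natz mulr_natl.
Qed.

(** The number of roots of f modulo p, written rho(p) above. *)
Definition nroots (f : {poly int}) (p : nat) : nat :=
  #|[pred t : 'I_p | (p%:Z %| f.[(t : nat)%:Z])%Z]|.

Lemma Fp_horner (f : {poly int}) (p : nat) (z : int) :
  (map_poly (intr : int -> 'F_p) f).[z%:~R] = (f.[z])%:~R.
Proof. exact: horner_map. Qed.

Lemma nroots_le (f : {poly int}) (p : nat) :
  prime p -> ~~ (p%:Z %| lead_coef f)%Z -> (nroots f p <= (size f).-1)%N.
Proof.
move=> pp pl.
pose fp := map_poly (intr : int -> 'F_p) f.
have lc0 : (lead_coef f)%:~R != 0 :> 'F_p by rewrite Fp_intr_eq0.
have sfp : size fp = size f by rewrite size_map_poly_id0.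
have fp0 : fp != 0.
  rewrite -size_poly_gt0 sfp size_poly_gt0; apply: contraNneq pl => ->.
  by rewrite lead_coef0 dvdz0.
pose g (t : 'I_p) : 'F_p := ((t : nat)%:Z)%:~R.
have ginj : injective g.
  move=> a b /eqP; rewrite -subr_eq0 -intrB Fp_intr_eq0 // -eqz_mod_dvd.
  by rewrite !modz_nat !modn_small // => /eqP [] ab; exact: val_inj.
set A := [pred t : 'I_p | (p%:Z %| f.[(t : nat)%:Z])%Z].
have : (size (map g (enum A)) < size fp)%N.
  apply: (@max_poly_roots 'F_p fp _ fp0); last by rewrite map_inj_uniq // enum_uniq.
  apply/allP => _ /mapP[t tA ->]; move: tA; rewrite mem_enum inE => Ht.
  by rewrite /root /g Fp_horner Fp_intr_eq0.
by rewrite size_map -cardE sfp /nroots -/A; case: (size f).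
Qed.

(** If w vanishes modulo p at k distinct roots of F modulo p, then p^k divides
    the norm of w. *)
Lemma card_roots_le_logn n (F : {poly int}) (M : 'M[int]_n.+1) (p : nat) (w : 'rV[int]_n.+1) :
  irreducible_poly F -> F \is monic -> size F = n.+2 -> horner_mx M F = 0 ->
  (forall t, M *m powcol n.+1 t = t *: powcol n.+1 t - F.[t] *: delta_mx ord_max 0) ->
  prime p -> w != 0 ->
  (#|[pred t : 'I_p | (p%:Z %| F.[(t : nat)%:Z])%Z && (evalmod p t w == 0)%R]|
     <= logn p `|\det (orbitmx M w)|)%N.
Proof.
move=> Firr Fmon sF HF HM pp w0.
set A := [pred t : 'I_p | _].
have D0 : (0 < `|\det (orbitmx M w)|)%N by rewrite absz_gt0; exact: det_orbitmx_neq0 HF w0.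
rewrite -pfactor_dvdn // cardE -(size_map val).
apply: prime_pow_dvd_det => //.
- rewrite map_inj_uniq ?enum_uniq //; exact: val_inj.
- apply/allP => _ /mapP[t _ ->]; exact: ltn_ord.
- rewrite size_map -cardE; apply: (@leq_trans (nroots F p)).
    by apply: subset_leq_card; apply/fintype.subsetP => t; rewrite !inE => /andP[].
  have := @nroots_le F p pp; rewrite sF (eqP Fmon); apply.
  by rewrite dvdzE /= dvdn1; have := prime_gt1 pp; case: eqP => // ->.
- move=> _ /mapP[t tA ->] i; move: tA; rewrite mem_enum inE => /andP[Ft wt].
  apply: orbitmx_powcol; last by rewrite -evalmod_eq0.
  move=> k; rewrite HM addrAC subrr add0r !mxE rpredN; exact: dvdz_mulr.
Qed.

(** * Logarithms of natural numbers *)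

Lemma ln_natr_ge0 (R : realType) (k : nat) : 0 <= ln k%:R :> R.
Proof.
case: k => [|k]; first by rewrite ln0.
by rewrite ln_ge0 // ler1n.
Qed.

Lemma le_ln_natr (R : realType) (a b : nat) : (a <= b)%N -> ln a%:R <= ln b%:R :> R.
Proof.
case: a => [|a] ab; first by rewrite ln0 // ln_natr_ge0.
by rewrite ler_ln ?posrE ?ltr0n ?ler_nat //; exact: leq_trans ab.
Qed.

Lemma ln_natrX (R : realType) (a k : nat) : ln (a ^ k)%N%:R = k%:R * ln a%:R :> R.
Proof.
case: a => [|a]; last by rewrite natrX lnXn ?ltr0n // mulr_natl.
by case: k => [|k]; rewrite ?expn0 ?ln1 ?mul0r // exp0n // ln0 // mulr0.
Qed.

Lemma ln_natrM (R : realType) (a b : nat) : (0 < a)%N -> (0 < b)%N ->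
  ln (a * b)%N%:R = ln a%:R + ln b%:R :> R.
Proof. by move=> a0 b0; rewrite natrM lnM ?posrE ?ltr0n. Qed.

Lemma ln_natr_prod (R : realType) (I : Type) (s : seq I) (P : pred I) (F : I -> nat) :
  (forall i, P i -> 0 < F i)%N ->
  ln (\prod_(i <- s | P i) F i)%N%:R = \sum_(i <- s | P i) ln (F i)%:R :> R.
Proof.
move=> F0; elim: s => [|i s IH]; first by rewrite !big_nil ln1.
rewrite !big_cons; case: ifP => // Pi.
by rewrite ln_natrM ?IH ?F0 // prodn_cond_gt0.
Qed.

Lemma ler_sum_nat_widen (R : realType) (a b : nat) (P : pred nat) (F : nat -> R) :
  (a <= b)%N -> (forall i, P i -> 0 <= F i) ->
  \sum_(0 <= i < a | P i) F i <= \sum_(0 <= i < b | P i) F i.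
Proof.
move=> ab F0; rewrite [leRHS](big_cat_nat (n := a)) //= lerDl.
by apply: sumr_ge0.
Qed.

Lemma ln_eq_sum_logn (R : realType) (D X : nat) : (0 < D)%N -> (D < X)%N ->
  ln D%:R = \sum_(0 <= p < X | prime p) (logn p D)%:R * ln p%:R :> R.
Proof.
move=> D0 DX.
have E : D = (\prod_(0 <= p < X | prime p) p ^ logn p D)%N.
  rewrite -{1}[D]partnT // (@widen_partn X.-1) //; last by lia.
  rewrite prednK; last by lia.
  (* The factor at a non-prime p is p ^ 0. *)
  rewrite big_mkcond [RHS]big_mkcond; apply: eq_bigr => p _ /=.
  by case: ifP => // pp; rewrite lognE pp expn0.
rewrite {1}E ln_natr_prod => [|p pp]; last by rewrite expn_gt0 prime_gt0.
by apply: eq_bigr => p _; rewrite ln_natrX.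
Qed.

Lemma sum_logn_le_ln (R : realType) (D X : nat) : (0 < D)%N ->
  \sum_(0 <= p < X | prime p) (logn p D)%:R * ln p%:R <= ln D%:R :> R.
Proof.
move=> D0; rewrite (@ln_eq_sum_logn R D (maxn X D.+1)) //; last by lia.
by apply: ler_sum_nat_widen => [|p _]; [lia | rewrite mulr_ge0 // ln_natr_ge0].
Qed.

Lemma exists_nat_ge (R : realType) (x : R) : exists k : nat, x <= k%:R.
Proof.
exists (Num.bound `|x|); apply: le_trans (ler_norm x) _.
exact: ltW (archi_boundP (normr_ge0 x)).
Qed.

Lemma ln_natr_le (R : realType) (N : nat) : (0 < N)%N -> ln N%:R <= N%:R :> R.
Proof.
move=> N0; have -> : N%:R = 1 + (N%:R - 1) :> R by rewrite addrC subrK.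
have N1 : 1 <= N%:R :> R by rewrite ler1n.
apply: le_trans (le_ln1Dx _) _; lra.
Qed.

Lemma exists_ln_ge (R : realType) (c : R) : exists N0 : nat, forall N : nat,
  (N0 <= N)%N -> (1 < N)%N /\ c <= ln N%:R.
Proof.
have [k Hk] := exists_nat_ge (expR c).
exists (k + 2)%N => N kN; split; first by lia.
rewrite -[leLHS]expRK ler_ln ?posrE ?expR_gt0 ?ltr0n //; last by lia.
by apply: le_trans Hk _; rewrite ler_nat; lia.
Qed.

(** * Weighted averages of the number of roots modulo primes *)

(** The sum of rho(p) log p / p over the primes p <= X. *)
Definition root_sum (R : realType) (f : {poly int}) (X : nat) : R :=
  \sum_(0 <= p < X.+1 | prime p) (nroots f p)%:R * ln p%:R / p%:R.

(** A double count of the pairs formed of a nonzero vector of the box and of a root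
    of F modulo p at which it vanishes.  Discarding the zero vector costs 1 for
    each root, which turns J^(n+1) into J^(n+1) - 1 because 1 <= m^(n+1) / p. *)
Lemma root_count_lower n (F : {poly int}) (p J E m : nat) :
  prime p -> (p <= m ^ n.+1)%N ->
  (forall t : nat, (p%:Z %| F.[t%:Z])%Z -> forall v : 'rV[int]_n.+1, exists u : 'rV[int]_n.+1,
    evalmod p t u = evalmod p t v /\ forall j, 0 <= u 0 j <= (E * m)%N%:Z) ->
  (nroots F p * ((J ^ n.+1 - 1) * m ^ n.+1) <= p *
   \sum_(a : {ffun 'I_n.+1 -> 'I_(J * m + E * m)} | boxvec a != 0%R)
     #|[pred t : 'I_p | (p%:Z %| F.[(t : nat)%:Z])%Z && (evalmod p t (boxvec a) == 0)%R]|)%N.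
Proof.
move=> pp pm cover.
pose T : finType := {ffun 'I_n.+1 -> 'I_(J * m + E * m)}.
have -> : (\sum_(a : T | boxvec a != 0%R)
     #|[pred t : 'I_p | (p%:Z %| F.[(t : nat)%:Z])%Z && (evalmod p t (boxvec a) == 0)%R]|
  = \sum_(t : 'I_p | (p%:Z %| F.[(t : nat)%:Z])%Z)
      #|[pred a : T | (boxvec a != 0%R) && (evalmod p t (boxvec a) == 0)%R]|)%N.
  under eq_bigr do rewrite -sum1_card.
  under [RHS]eq_bigr do rewrite -sum1_card.
  rewrite (exchange_big_dep (fun t : 'I_p => (p%:Z %| F.[(t : nat)%:Z])%Z)) /=.
    by apply: eq_bigr => t Ft; apply: eq_bigl => a; rewrite !inE Ft.
  by move=> a t _; rewrite inE => /andP[].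
rewrite big_distrr /= /nroots -sum1_card big_distrl /=.
apply: leq_sum => t Ft; rewrite mul1n.
set A := [pred a | _].
have := lattice_count (J * m) pp (cover t Ft).
set L := #|_|.
have LA : (L <= #|A| + 1)%N.
  rewrite /L -(cardID [pred a : T | boxvec a != 0%R]) leq_add //.
    by apply: subset_leq_card; apply/fintype.subsetP => a; rewrite !inE andbC.
  apply/card_le1_eqP => a b; rewrite !inE !negbK => /andP[/eqP a0 _] /andP[/eqP b0 _].
  apply/ffunP => j; apply/val_inj => /=.
  have := congr1 (fun v : 'rV_n.+1 => v 0 j) (etrans a0 (esym b0)).
  by rewrite !mxE => -[].
rewrite expnMn mulnBl mul1n => H.
have {}LA : (p * L <= p * (#|A| + 1))%N by rewrite leq_mul2l LA orbT.
rewrite leq_subLR addnC; apply: leq_trans H _; apply: leq_trans LA _.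
by rewrite mulnDr muln1 leq_add2l.
Qed.

(** The sum of the logarithms of the norms of the nonzero vectors of a box of side
    (J + C1) m, bounded from above by the size of the determinants and from below
    by the contribution of the primes p <= m^(n+1). *)
Lemma landau_ineq (R : realType) n (F : {poly int}) :
  irreducible_poly F -> F \is monic -> size F = n.+2 ->
  exists C1 C2 : nat, (0 < C2)%N /\ forall J m : nat, (0 < J)%N -> (0 < m)%N ->
   (J ^ n.+1 - 1)%N%:R * root_sum R F (m ^ n.+1) <=
   ((J + C1) ^ n.+1)%N%:R * ln (C2 * ((J + C1) * m) ^ n.+1)%N%:R.
Proof.
move=> Firr Fmon sF.
have [M [HF HM]] := companion_powcol Fmon sF.
have [C0 HC0] := orbitmx_bound M.
have [C1 HC1] := lattice_cover Firr sF HF HM.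
(* The norm of a vector of the box of side H is at most C2 * H ^ n.+1; the
   successor makes C2 positive. *)
pose C2 := ((n.+1)`! * C0 ^ n.+1).+1.
exists C1, C2; split => // J m J0 m0.
pose H := (J * m + C1 * m)%N.
have EH : H = ((J + C1) * m)%N by rewrite mulnDl.
rewrite -EH.
pose T : finType := {ffun 'I_n.+1 -> 'I_H}.
pose D (a : T) := `|\det (orbitmx M (boxvec a))|%N.
pose k p (a : T) :=
  #|[pred t : 'I_p | (p%:Z %| F.[(t : nat)%:Z])%Z && (evalmod p t (boxvec a) == 0)%R]|.
have H0 : (0 < H)%N by rewrite EH muln_gt0 addn_gt0 J0.
pose B : R := ln (C2 * H ^ n.+1)%N%:R.
have up : \sum_(a : T | boxvec a != 0) ln (D a)%:R <= (H ^ n.+1)%N%:R * B.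
  apply: (@le_trans _ _ (\sum_(a : T) B)).
    rewrite big_mkcond /=; apply: ler_sum => a _.
    case: ifP => [a0|_]; last exact: ln_natr_ge0.
    apply: le_ln_natr.
    have := @det_bound _ (orbitmx M (boxvec a)) (C0 * H).
    rewrite expnMn mulnA => HD; apply: leq_trans (HD _) _ => //.
      by apply: HC0 => j; rewrite mxE /= lez_nat ltnW // ltn_ord.
    by rewrite leq_mul2r leqnSn orbT.
  by rewrite sumr_const card_ffun !card_ord mulr_natl.
have low : \sum_(0 <= p < (m ^ n.+1).+1 | prime p)
     ((\sum_(a : T | boxvec a != 0%R) k p a)%N%:R * ln p%:R) <=
     \sum_(a : T | boxvec a != 0) ln (D a)%:R :> R.
  under eq_bigr do rewrite natr_sum mulr_suml.
  rewrite exchange_big /=; apply: ler_sum => a a0.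
  have Da0 : (0 < D a)%N by rewrite absz_gt0; exact: det_orbitmx_neq0 HF a0.
  apply: le_trans (sum_logn_le_ln R (m ^ n.+1).+1 Da0).
  apply: ler_sum => p pp; rewrite ler_wpM2r ?ln_natr_ge0 // ler_nat.
  exact: card_roots_le_logn.
have {}low : (J ^ n.+1 - 1)%N%:R * root_sum R F (m ^ n.+1) * (m ^ n.+1)%N%:R <=
    (H ^ n.+1)%N%:R * B.
  apply: le_trans (le_trans low up).
  rewrite /root_sum mulrAC mulr_sumr big_nat_cond [leRHS]big_nat_cond.
  apply: ler_sum => p /andP[/andP[_ pm] pp].
  have p0 : 0 < p%:R :> R by rewrite ltr0n prime_gt0.
  have := @root_count_lower n F p J C1 m pp pm (fun t Ft => HC1 p t m pp Ft pm).
  rewrite -/T -(ler_nat R) [X in _ <= X]natrM !natrM => Hc.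
  have -> : (J ^ n.+1 - 1)%N%:R * (m ^ n.+1)%N%:R * ((nroots F p)%:R * ln p%:R / p%:R) =
    ((nroots F p)%:R * ((J ^ n.+1 - 1)%N%:R * (m ^ n.+1)%N%:R)) / p%:R * ln p%:R :> R by ring.
  by rewrite ler_wpM2r ?ln_natr_ge0 // ler_pdivrMr // [leRHS]mulrC.
have m0R : 0 < (m ^ n.+1)%N%:R :> R by rewrite ltr0n expn_gt0 m0.
rewrite -(ler_pM2r m0R); apply: le_trans low _.
by rewrite -/B {1}EH expnMn natrM mulrAC lexx.
Qed.

(** The monic polynomial c^n f(x / c), where f has degree n + 1 and leading
    coefficient c. *)
Definition monicization n (f : {poly int}) : {poly int} :=
  \poly_(i < n.+2) (if i == n.+1 then 1 else lead_coef f ^+ (n - i) * f`_i).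

Lemma monicizationP n (f : {poly int}) : irreducible_poly f -> size f = n.+2 ->
  let F := monicization n f in
  [/\ F \is monic, size F = n.+2, irreducible_poly F &
      F \Po (lead_coef f *: 'X) = lead_coef f ^+ n *: f].
Proof.
move=> [s1 firr] sf F.
have sF : size F = n.+2 by rewrite size_poly_eq // eqxx oner_eq0.
have f0 : f != 0 by rewrite -size_poly_gt0 sf.
have c0 : lead_coef f != 0 by rewrite lead_coef_eq0.
set c := lead_coef f in c0 *.
have Fmon : F \is monic.
  by rewrite monicE lead_coefE sF coef_poly ltnSn eqxx.
have sq (q : {poly int}) : size (q \Po (c *: 'X)) = size q.
  by rewrite size_comp_poly2 // size_scale // size_polyX.
have compE (q : {poly int}) i : (q \Po (c *: 'X))`_i = c ^+ i * q`_i.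
  have [iq|iq] := ltnP i (size q); last first.
    by rewrite [q`_i]nth_default // mulr0 nth_default // sq.
  rewrite comp_polyE coef_sum (bigD1 (Ordinal iq)) //= big1 ?addr0.
    by rewrite exprZn !coefZ coefXn eqxx mulr1 mulrC.
  move=> j; rewrite -val_eqE /= => ji.
  by rewrite exprZn !coefZ coefXn eq_sym (negPf ji) !mulr0.
have FE : F \Po (c *: 'X) = c ^+ n *: f.
  apply/polyP => i; rewrite compE coefZ coef_poly.
  case: ltnP => [ilt|ige]; last by rewrite [f`_i]nth_default ?sf // !mulr0.
  case: eqVneq => [->|ni]; first by rewrite mulr1 exprSr /c lead_coefE sf.
  have iln : (i <= n)%N by lia.
  by rewrite mulrA -exprD subnKC.
split => //; split; first by rewrite sF.
move=> q s1q qF.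
have qf : q \Po (c *: 'X) %| f.
  by rewrite -(dvdpZr _ _ (expf_neq0 n c0)) -FE dvdp_comp_poly.
have := firr _ _ qf; rewrite sq => /(_ s1q) /eqp_size; rewrite sq => sqf.
by rewrite -dvdp_size_eqp // sqf sf sF.
Qed.

(** The map t |-> c t sends the roots of f modulo p to those of its
    monicization. *)
Lemma nroots_monicization n (f : {poly int}) (p : nat) : irreducible_poly f ->
  size f = n.+2 -> prime p -> ~~ (p%:Z %| lead_coef f)%Z ->
  (nroots f p <= nroots (monicization n f) p)%N.
Proof.
move=> firr sf pp pc.
have [_ _ _ FE] := monicizationP firr sf.
set F := monicization n f in FE *; set c := lead_coef f in pc FE *.
have lt (t : 'I_p) : (`|((c * (t : nat)%:Z) %% p%:Z)%Z| < p)%N.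
  have p0 : p%:Z != 0 :> int by have := prime_gt0 pp; lia.
  have := ltz_mod (c * (t : nat)%:Z) p0.
  by have := modz_ge0 (c * (t : nat)%:Z) p0; lia.
pose g t := Ordinal (lt t).
have gE t : ((g t : nat)%:Z = c * (t : nat)%:Z %[mod p%:Z])%Z.
  rewrite /= gez0_abs ?modz_mod // modz_ge0 //.
  by have := prime_gt0 pp; lia.
have ginj : injective g.
  move=> a b ab; have := gE a; rewrite ab gE => /eqP.
  have pc' : (p %| `|c|)%N = false by apply: negbTE; rewrite dvdzE in pc.
  rewrite eqz_mod_dvd -mulrBr dvdzE abszM Euclid_dvdM // pc' /=.
  rewrite -[X in (X %| _)%N]/(`|p%:Z|)%N -dvdzE.
  by rewrite -eqz_mod_dvd !modz_nat !modn_small // => /eqP [] /esym; exact: val_inj.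
rewrite /nroots -(card_imset _ ginj); apply: subset_leq_card.
apply/fintype.subsetP => _ /imsetP[t ft ->]; move: ft; rewrite !inE => ft.
have H : (p%:Z %| F.[c * (t : nat)%:Z])%Z.
  have -> : F.[c * (t : nat)%:Z] = c ^+ n * f.[(t : nat)%:Z].
    by rewrite -hornerZ -FE horner_comp hornerZ hornerX.
  exact: dvdz_mull.
have : (p%:Z %| F.[(g t : nat)%:Z] - F.[c * (t : nat)%:Z])%Z.
  rewrite -Fp_intr_eq0 // intrB -!Fp_horner subr_eq0; apply/eqP; congr (_.[_]).
  apply/eqP; rewrite -subr_eq0 -intrB Fp_intr_eq0 // -eqz_mod_dvd; exact/eqP.
by rewrite rpredBr.
Qed.

Lemma expr1D_le (R : realFieldType) (x : R) (d : nat) : 0 <= x <= 1 ->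
  (1 + x) ^+ d <= 1 + 2 ^+ d * x.
Proof.
move=> /andP[x0 x1].
(* The bound is strengthened to make the induction go through. *)
suff : (1 + x) ^+ d <= 1 + (2 ^+ d - 1) * x by lra.
elim: d => [|d IH]; first by rewrite !expr0; lra.
rewrite exprS (exprS 2).
apply: (@le_trans _ _ ((1 + x) * (1 + (2 ^+ d - 1) * x))); first by rewrite ler_wpM2l //; lra.
have h1 : 1 <= 2 ^+ d :> R by rewrite exprn_ege1 // ler1n.
have : (2 ^+ d - 1) * x * x <= (2 ^+ d - 1) * x * 1 by rewrite ler_wpM2l // mulr_ge0 //; lra.
lra.
Qed.

(** The ratio of the two constants of [landau_ineq] tends to 1 as J grows. *)
Lemma expn_ratio (R : realType) (C d : nat) (eps : R) : 0 < eps -> (0 < d)%N ->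
  exists J : nat, (0 < J)%N /\
   0 < (J ^ d - 1)%N%:R :> R /\ ((J + C) ^ d)%N%:R <= (1 + eps) * (J ^ d - 1)%N%:R.
Proof.
move=> e0 d0.
have [J0 HJ0] := exists_nat_ge ((2 ^+ d * C%:R + 1 + eps) / eps).
pose J := (J0 + C + 2)%N.
exists J; split; first by rewrite /J; lia.
have J1 : (1 < J)%N by rewrite /J; lia.
have JR : 1 < J%:R :> R by rewrite ltr1n.
have JJ : (J <= J ^ d)%N by rewrite -[leqLHS]expn1 leq_exp2l.
have JdR : J%:R <= (J ^ d)%N%:R :> R by rewrite ler_nat.
have -> : (J ^ d - 1)%N%:R = (J ^ d)%N%:R - 1 :> R by rewrite natrB //; lia.
split; first by lra.
have J00 : 0 < J%:R :> R by lra.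
have CJ : C%:R <= J%:R :> R by rewrite ler_nat /J; lia.
have C0 : 0 <= C%:R :> R by rewrite ler0n.
have x01 : 0 <= (C%:R / J%:R : R) <= 1.
  by apply/andP; split; [rewrite divr_ge0 // ltW | rewrite ler_pdivrMr // mul1r].
have HJ : 2 ^+ d * C%:R + 1 + eps <= eps * J%:R.
  rewrite [leRHS]mulrC -ler_pdivrMr //; apply: le_trans HJ0 _; rewrite ler_nat /J; lia.
have -> : ((J + C) ^ d)%N%:R = (J ^ d)%N%:R * (1 + C%:R / J%:R) ^+ d :> R.
  rewrite !natrX -exprMn mulrDr mulr1 mulrCA divff ?mulr1 ?natrD //; lra.
have H1 := expr1D_le d x01.
apply: (@le_trans _ _ ((J ^ d)%N%:R * (1 + 2 ^+ d * (C%:R / J%:R)))).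
  by rewrite ler_wpM2l //; lra.
have [z zJ ->] : exists2 z : R, z * J%:R = 1 & J%:R^-1 = z.
  by exists J%:R^-1 => //; rewrite mulVf //; lra.
have z0 : 0 < z by nra.
have H2 : 2 ^+ d * (C%:R * z) + (1 + eps) * z <= eps.
  have : (2 ^+ d * C%:R + 1 + eps) * z <= eps * J%:R * z by rewrite ler_pM2r.
  rewrite -mulrA (mulrC J%:R) zJ; lra.
set Y := (J ^ d)%N%:R in JdR *.
have H3 : 1 <= Y * z by rewrite -zJ mulrC ler_pM2r.
have H4 : Y * (1 + 2 ^+ d * (C%:R * z)) <= Y * (1 + eps - (1 + eps) * z).
  rewrite ler_wpM2l //; lra.
apply: le_trans H4 _.
have : (1 + eps) * 1 <= (1 + eps) * (Y * z) by rewrite ler_wpM2l //; lra.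
lra.
Qed.

(** An approximate d-th root of X, rounded up. *)
Lemma exists_root_ceil (d X : nat) : (0 < d)%N -> (0 < X)%N ->
  exists m : nat, [/\ (0 < m)%N, (X <= m ^ d)%N & (m ^ d <= 2 ^ d * X)%N].
Proof.
move=> d0 X0.
have ex : exists m, (X <= m ^ d)%N by exists X; rewrite -[leqLHS]expn1 leq_pexp2l.
case: (ex_minnP ex) => m Xm mmin; exists m.
have m0 : (0 < m)%N by case: m Xm {mmin} => //; rewrite exp0n //; lia.
split=> //.
have : (m.-1 ^ d < X)%N by rewrite ltnNge; apply/negP => /mmin; lia.
move=> mX; have [m1|m1] := leqP m 1.
  have -> : m = 1%N by lia.
  by rewrite exp1n muln_gt0 expn_gt0 X0.
apply: (@leq_trans ((2 * m.-1) ^ d)); first by rewrite leq_exp2r //; lia.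
by rewrite expnMn leq_mul2l ltnW ?orbT.
Qed.

Lemma root_sum_mono (R : realType) (f : {poly int}) (X Y : nat) : (X <= Y)%N ->
  root_sum R f X <= root_sum R f Y.
Proof.
move=> XY; apply: ler_sum_nat_widen => // p _.
by rewrite divr_ge0 // mulr_ge0 // ln_natr_ge0.
Qed.

Lemma root_sum_monic_le (R : realType) n (F : {poly int}) (eps : R) :
  irreducible_poly F -> F \is monic -> size F = n.+2 -> 0 < eps ->
  exists C : R, forall X, (0 < X)%N -> root_sum R F X <= (1 + eps) * ln X%:R + C.
Proof.
move=> Firr Fmon sF e0.
have [C1 [C2 [C20 H]]] := landau_ineq R Firr Fmon sF.
have [J [J0 [JR HJ]]] := expn_ratio C1 e0 (ltn0Sn n).
exists ((1 + eps) * ln (C2 * (J + C1) ^ n.+1 * 2 ^ n.+1)%N%:R) => X X0.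
have [m [m0 Xm mX]] := exists_root_ceil (ltn0Sn n) X0.
apply: le_trans (root_sum_mono R F Xm) _.
have JC0 : (0 < J + C1)%N by lia.
have K0 : (0 < C2 * (J + C1) ^ n.+1 * 2 ^ n.+1)%N by rewrite !muln_gt0 C20 !expn_gt0 JC0.
rewrite -mulrDr -ln_natrM // -(ler_pM2l JR).
apply: le_trans (H J m J0 m0) _.
rewrite mulrA [_ * (1 + eps)]mulrC.
apply: ler_pM => //; first exact: ln_natr_ge0.
by apply: le_ln_natr; rewrite expnMn mulnA [leqRHS]mulnC -[leqRHS]mulnA leq_mul2l mX orbT.
Qed.

(** The primes which divide the leading coefficient c contribute at most
    log |c|. *)
Lemma root_sum_le (R : realType) n (f : {poly int}) (eps : R) :
  irreducible_poly f -> size f = n.+2 -> 0 < eps ->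
  exists C : R, forall X, (0 < X)%N -> root_sum R f X <= (1 + eps) * ln X%:R + C.
Proof.
move=> firr sf e0.
have [Fmon sF Firr _] := monicizationP firr sf.
have [C HC] := root_sum_monic_le Firr Fmon sF e0.
exists (C + ln `|lead_coef f|%N%:R) => X X0.
rewrite addrA; apply: le_trans (lerD (HC X X0) _); first last.
  apply: (@sum_logn_le_ln R _ X.+1).
  by rewrite absz_gt0 lead_coef_eq0 -size_poly_gt0 sf.
rewrite /root_sum -big_split; apply: ler_sum => p pp /=.
have p0 : 0 < p%:R :> R by rewrite ltr0n prime_gt0.
have [pc|pc] := boolP (p%:Z %| lead_coef f)%Z.
  rewrite -[leLHS]add0r lerD //.
    by rewrite divr_ge0 // mulr_ge0 // ln_natr_ge0.
  rewrite mulrAC ler_wpM2r ?ln_natr_ge0 //.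
  apply: (@le_trans _ _ 1).
    rewrite ler_pdivrMr // mul1r ler_nat.
    by apply: leq_trans (max_card _) _; rewrite card_ord.
  rewrite ler1n logn_gt0 mem_primes pp absz_gt0 lead_coef_eq0 -size_poly_gt0 sf /=.
  by rewrite dvdzE in pc.
rewrite -[leLHS]addr0 lerD //; last by rewrite mulr_ge0 // ln_natr_ge0.
rewrite ler_wpM2r // ?invr_ge0 // ler_wpM2r ?ln_natr_ge0 // ler_nat.
exact: nroots_monicization.
Qed.

(** * The primes have density zero *)

Lemma central_bin_le (k : nat) : ('C(k + k, k) <= 4 ^ k)%N.
Proof.
have : ((1 + 1) ^ (k + k) = 4 ^ k)%N by rewrite (_ : k + k = 2 * k)%N ?expnM //; lia.
rewrite expnDn => <-; have kk : (k < (k + k).+1)%N by lia.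
by rewrite (bigD1 (Ordinal kk)) //= !exp1n !muln1 leq_addr.
Qed.

Lemma prime_ndvd_fact (p k : nat) : prime p -> (k < p)%N -> ~~ (p %| k`!)%N.
Proof.
move=> pp; elim: k => [|k IH] kp; first by rewrite dvdn1 neq_ltn prime_gt1 // orbT.
rewrite factS Euclid_dvdM // negb_or IH ?andbT; last by lia.
by apply/negP => /dvdn_leq; lia.
Qed.

(** The primes p with k < p <= 2 k all divide the central binomial coefficient,
    which is at most 4^k. *)
Lemma primes_dyadic (R : realType) (k : nat) : (0 < k)%N ->
  (\sum_(k.+1 <= p < (k + k).+1 | prime p) 1)%N%:R * ln k%:R <= k%:R * ln 4 :> R.
Proof.
move=> k0.
have B0 : (0 < 'C(k + k, k))%N by rewrite bin_gt0 leq_addr.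
have -> : k%:R * ln 4 = ln (4 ^ k)%N%:R :> R by rewrite ln_natrX.
apply: le_trans (le_ln_natr R (central_bin_le k)).
apply: le_trans (sum_logn_le_ln R (k + k).+1 B0).
rewrite [leRHS](big_cat_nat (n := k.+1)) //=; last by lia.
rewrite -[leLHS]add0r; apply: lerD.
  by apply: sumr_ge0 => p _; rewrite mulr_ge0 // ln_natr_ge0.
rewrite natr_sum mulr_suml [leLHS]big_nat_cond [leRHS]big_nat_cond.
apply: ler_sum => p /andP[/andP[kp pk] pp]; rewrite mul1r.
have lk : ln k%:R <= ln p%:R :> R by apply: le_ln_natr; lia.
apply: le_trans lk _; rewrite ler_peMl ?ln_natr_ge0 // ler1n.
rewrite logn_gt0 mem_primes pp B0 /=.
have := bin_fact (leq_addr k k); rewrite addnK => H.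
have : (p %| (k + k)`!)%N by rewrite dvdn_fact //; lia.
have nk : ~~ (p %| k`!)%N by apply: prime_ndvd_fact.
by rewrite -H !Euclid_dvdM // (negPf nk) !orbF.
Qed.

(** The number of primes p <= n. *)
Definition prime_count (n : nat) : nat := (\sum_(0 <= p < n.+1 | prime p) 1)%N.

Lemma prime_count_small (R : realType) (delta : R) : 0 < delta ->
  exists C : R, 0 <= C /\ forall n : nat, (prime_count n)%:R <= delta * n%:R + C.
Proof.
move=> d0.
have [n0 Hn0] := exists_nat_ge (expR (4 * ln 4 / delta)).
exists (n0 + n0 + 2)%N%:R; split => //.
have triv n : (prime_count n <= n.+1)%N.
  rewrite /prime_count -[leqRHS](subn0) -[leqRHS]muln1 -sum_nat_const_nat.
  by rewrite big_mkcond; apply: leq_sum => i _; case: ifP.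
elim/ltn_ind => n IH.
have [nsmall|nbig] := leqP n (n0 + n0 + 1).
  apply: (@le_trans _ _ (n0 + n0 + 2)%N%:R).
    by rewrite ler_nat; apply: leq_trans (triv n) _; lia.
  by rewrite lerDr mulr_ge0 // ltW.
have n2N : (2 <= n)%N by lia.
(* The primes up to n are those up to k = uphalf n and some of those in (k, 2 k]. *)
pose k := uphalf n.
have kn : (k < n)%N by rewrite /k; lia.
have nkk : (n <= k + k)%N by rewrite /k; lia.
have kk1 : (k + k <= n + 1)%N by rewrite /k; lia.
have k0 : (0 < k)%N by lia.
have n0k : (n0 <= k)%N by lia.
have step : (prime_count n <= prime_count k + \sum_(k.+1 <= p < (k + k).+1 | prime p) 1)%N.
  rewrite /prime_count -big_cat_nat //=; last by lia.
  rewrite [leqRHS](big_cat_nat (n := n.+1)) //= ?leq_addr //; lia.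
have dy := primes_dyadic R k0.
set s := (\sum_(k.+1 <= p < _ | prime p) 1)%N in step dy.
have kR : 0 < k%:R :> R by rewrite ltr0n.
have lnk : 4 * ln 4 / delta <= ln k%:R :> R.
  rewrite -[leLHS]expRK ler_ln ?posrE ?expR_gt0 //.
  by apply: le_trans Hn0 _; rewrite ler_nat.
have l4 : 0 < ln 4 :> R by rewrite ln_gt0 // ltr1n.
have lk : 4 * ln 4 <= ln k%:R * delta by rewrite -ler_pdivrMr.
have sb : s%:R <= delta / 4 * k%:R.
  rewrite -(ler_pM2r l4).
  have : s%:R * (4 * ln 4) <= s%:R * (ln k%:R * delta) by rewrite ler_wpM2l.
  have : s%:R * ln k%:R * delta <= k%:R * ln 4 * delta by rewrite ler_pM2r.
  lra.
have IHk := IH k kn.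
have stepR : (prime_count n)%:R <= (prime_count k)%:R + s%:R :> R by rewrite -natrD ler_nat.
have kkR : k%:R + k%:R <= n%:R + 1 :> R by rewrite -natrD natr1 ler_nat -addn1.
have n2 : 2 <= n%:R :> R by rewrite (ler_nat R 2 n).
have : delta * (5 * k%:R) <= delta * (4 * n%:R) by rewrite ler_wpM2l //; lra.
lra.
Qed.

(** * Valuations of the values of a polynomial *)

(** The integer D plays the role of the discriminant of f. *)
Lemma irredp_deriv_bezout n (f : {poly int}) : irreducible_poly f -> size f = n.+2 ->
  exists (u v : {poly int}) (D : int), D != 0 /\ u * f + v * f^`() = D%:P.
Proof.
move=> [_ firr] sf.
have f'0 : f^`() != 0.
  apply/eqP => /(congr1 (fun q : {poly int} => q`_n)); rewrite coef_deriv coef0 => /eqP.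
  rewrite mulrn_eq0 /= => /eqP fn; have : lead_coef f == 0 by rewrite lead_coefE sf fn.
  by rewrite lead_coef_eq0 -size_poly_eq0 sf.
have f0 : f != 0 by rewrite -size_poly_gt0 sf.
have cop : coprimep f f^`().
  rewrite /coprimep; apply/negPn/negP => /firr /(_ (dvdp_gcdl _ _)) /eqp_size sg.
  have := dvdp_leq f'0 (dvdp_gcdr f f^`()); rewrite sg => sf'.
  by have := leq_ltn_trans sf' (lt_size_deriv f0); rewrite ltnn.
have /Bezout_coprimepP[[u v] /= /eqpP[[c1 c2] /= /andP[c10 c20] E]] := cop.
exists (c1 *: u), (c1 *: v), c2; split => //.
by rewrite -!scalerAl -scalerDr E -mul_polyC mulr1.
Qed.

Lemma horner_taylor2 (f : {poly int}) (x y : int) :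
  exists q, f.[y] = f.[x] + (y - x) * (f^`().[x] + (y - x) * q).
Proof.
elim/poly_ind: f => [|f c [q IH]]; first by exists 0; rewrite deriv0 !horner0; ring.
exists (f^`().[x] + y * q); rewrite derivD derivM derivX derivC !hornerE IH; ring.
Qed.

(** A quantitative form of Hensel uniqueness: two numbers congruent modulo
    p^(e+1), with e = v_p(D), at which f is divisible by p^k, are congruent modulo
    p^(k-e). *)
Lemma val_diff_bound (f u v : {poly int}) (D x y : int) (p k : nat) :
  prime p -> D != 0 -> u * f + v * f^`() = D%:P ->
  (p%:Z ^+ (logn p `|D|).+1 %| y - x)%Z -> x != y ->
  (p%:Z ^+ k %| f.[x])%Z -> (p%:Z ^+ k %| f.[y])%Z ->
  (k <= logn p `|D| + logn p `|(y - x)%R|)%N.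
Proof.
move=> pp D0 E yx xy kx ky.
set e := logn p `|D| in yx *; set l := logn p _.
rewrite leqNgt; apply/negP => lk.
have [q Hq] := horner_taylor2 f x y.
set X := f^`().[x] + _ in Hq.
have d0 : (0 < `|(y - x)%R|)%N by rewrite absz_gt0 subr_eq0 eq_sym.
have pX : (p%:Z ^+ e.+1 %| X)%Z.
  have : (p%:Z ^+ (l + e.+1) %| (y - x) * X)%Z.
    have -> : (y - x) * X = f.[y] - f.[x] by rewrite Hq; ring.
    by apply: (@dvdz_trans (p%:Z ^+ k)); [rewrite dvdz_exp2l //; lia | rewrite rpredB].
  rewrite !dvdzE !abszX abszM /=.
  have [->|X0] := posnP `|X|%N; first by rewrite muln0 !dvdn0.
  by rewrite !pfactor_dvdn ?muln_gt0 ?d0 // lognM // leq_add2l.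
have pf' : (p%:Z ^+ e.+1 %| f^`().[x])%Z.
  have -> : f^`().[x] = X - (y - x) * q by rewrite /X; ring.
  by rewrite rpredB // dvdz_mulr.
have pf : (p%:Z ^+ e.+1 %| f.[x])%Z.
  by apply: dvdz_trans kx; rewrite dvdz_exp2l //; lia.
have : (p%:Z ^+ e.+1 %| D)%Z.
  have -> : D = u.[x] * f.[x] + v.[x] * f^`().[x].
    by have := congr1 (horner^~ x) E; rewrite !hornerE.
  by rewrite rpredD // dvdz_mull.
by rewrite dvdzE abszX /= pfactor_dvdn ?absz_gt0 // ltnn.
Qed.

Lemma logn_fact_sum (p k : nat) : logn p k`! = (\sum_(1 <= i < k.+1) logn p i)%N.
Proof.
elim: k => [|k IH]; first by rewrite big_geq // logn1.
by rewrite factS lognM ?fact_gt0 // IH [RHS]big_nat_recr //= addnC.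
Qed.

Lemma logn_fact_le (p N : nat) : prime p -> (logn p N`! * p.-1 <= N)%N.
Proof.
move=> pp; rewrite logn_fact // big_distrl /=.
(* Each term is at most N %/ p ^ k.-1 - N %/ p ^ k, and these differences
   telescope. *)
suff H m : (\sum_(1 <= k < m.+1) N %/ p ^ k * p.-1 + N %/ p ^ m <= N)%N.
  by apply: leq_trans (H N); apply: leq_addr.
elim: m => [|m IH]; first by rewrite big_geq // add0n expn0 divn1.
rewrite big_nat_recr //=; apply: leq_trans IH; rewrite -addnA leq_add2l.
rewrite expnSr divnMA; set a := (N %/ p ^ m)%N.
rewrite -mulnSr prednK ?prime_gt0 //; exact: leq_divM.
Qed.

(** The product of the distances from m to the other integers of [1, N] is
    (m - 1)! (N - m)!, which divides N!. *)
Lemma sum_logn_dist (p N m : nat) : (0 < m <= N)%N ->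
  (\sum_(1 <= n < N.+1 | n != m) logn p `|(n%:Z - m%:Z)%R| <= logn p N`!)%N.
Proof.
move=> /andP[m0 mN].
have -> : (\sum_(1 <= n < N.+1 | n != m) logn p `|(n%:Z - m%:Z)%R| =
   logn p (m.-1)`! + logn p (N - m)`!)%N.
  rewrite (big_cat_nat (n := m)) //=; last by lia.
  rewrite [X in (_ + X)%N](big_ltn_cond) // eqxx /=; congr (_ + _)%N.
    rewrite logn_fact_sum prednK // [RHS]big_nat_rev /= big_nat_cond [RHS]big_nat_cond.
    apply: eq_big => [i|i /andP[/andP[i1 im] _]]; first by lia.
    by congr (logn p _); lia.
  rewrite logn_fact_sum -{1}(add1n m) big_addn.
  rewrite (_ : N.+1 - m = (N - m).+1)%N; last by lia.
  rewrite big_nat_cond [RHS]big_nat_cond.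
  apply: eq_big => [i|i /andP[/andP[i1 im] _]]; first by lia.
  by congr (logn p _); lia.
rewrite -lognM ?fact_gt0 //; apply: dvdn_leq_log; rewrite ?fact_gt0 //.
have H : ((m.-1)`! * (N - m)`! %| m`! * (N - m)`!)%N.
  by rewrite dvdn_mul // -[in X in (_ %| X)%N](prednK m0) factS dvdn_mull.
apply: dvdn_trans H _.
by rewrite -(bin_fact mN) dvdn_mull.
Qed.

(** In a residue class modulo p^(e+1), the valuations of the f(n) are compared with
    the largest one, attained at m: those of the other n are at most
    e + v_p(n - m). *)
Lemma class_sum_bound (f u v : {poly int}) (D : int) (p N t V e : nat) :
  prime p -> D != 0 -> u * f + v * f^`() = D%:P ->
  (forall n, (0 < n <= N)%N -> f.[n%:Z] != 0) ->
  (forall n, (0 < n <= N)%N -> (logn p `|f.[n%:Z]| <= V)%N) ->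
  e = logn p `|D| ->
  (\sum_(1 <= n < N.+1 | n %% p ^ e.+1 == t) logn p `|f.[n%:Z]| <=
   \sum_(1 <= n < N.+1 | n %% p ^ e.+1 == t) e + (logn p N`! + V))%N.
Proof.
move=> pp D0 E f0 fV eE; set q := (p ^ e.+1)%N.
pose P (i : 'I_N.+1) := (0 < i)%N && (i %% q == t)%N.
have toP (F : nat -> nat) : (\sum_(1 <= n < N.+1 | (n %% q == t)%N) F n = \sum_(i : 'I_N.+1 | P i) F i)%N.
  rewrite -(big_mkord (fun i => (0 < i) && (i %% q == t))%N F).
  rewrite [RHS]big_ltn_cond //= big_nat_cond [RHS]big_nat_cond.
  by apply: eq_bigl => i; lia.
rewrite !toP.
case: (pickP P) => [i0 Pi0|P0]; last first.
  by rewrite big_pred0.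
pose g (i : 'I_N.+1) := logn p `|f.[(i : nat)%:Z]|.
have [m Pm mmax] := arg_maxnP g Pi0.
have /andP[m0 mt] := Pm.
have mN : (0 < m <= N)%N by rewrite m0 -ltnS ltn_ord.
rewrite (bigD1 m) //= [X in (_ <= X + _)%N](bigD1 m) //=.
suff H : (\sum_(i < N.+1 | P i && (i != m)) logn p `|f.[(i : nat)%:Z]| <=
    \sum_(i < N.+1 | P i && (i != m)) e + logn p N`!)%N.
  apply: leq_trans (leq_add (fV m mN) H) _.
  by rewrite addnC -!addnA leq_addl.
apply: (@leq_trans (\sum_(i < N.+1 | P i && (i != m)) (e + logn p `|((i : nat)%:Z - (m : nat)%:Z)%R|))%N).
  apply: leq_sum => i /andP[Pi im]; have /andP[i0' it] := Pi.
  have iN : (0 < i <= N)%N by rewrite i0' -ltnS ltn_ord.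
  rewrite eE; apply: (val_diff_bound pp D0 E).
  - rewrite -eE; have : (i == m %[mod q])%N by rewrite (eqP it) (eqP mt).
    move=> /eqP/(congr1 Posz)/eqP; rewrite -!modz_nat eqz_mod_dvd /q.
    by rewrite -[(p ^ _)%N%:Z]natz natrX natz.
  - by rewrite eqz_nat eq_sym.
  - rewrite dvdzE abszX /= pfactor_dvdn ?absz_gt0 ?f0 //; exact: mmax.
  - by rewrite dvdzE abszX /= pfactor_dvdn ?absz_gt0 ?f0.
rewrite big_split /= leq_add2l.
apply: leq_trans (sum_logn_dist p mN).
rewrite [leqRHS](_ : _ = \sum_(0 <= n < N.+1 | (0 < n) && (n != m)) logn p `|(n%:Z - (m:nat)%:Z)%R|)%N.
  rewrite big_mkord [leqLHS]big_mkcond [leqRHS]big_mkcond; apply: leq_sum => i _.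
  rewrite /P -val_eqE /=; case: (0 < i)%N => //=.
  by case: (i != m :> nat) => /=; rewrite ?andbF //; case: eqP.
rewrite [RHS]big_ltn_cond //= big_nat_cond [RHS]big_nat_cond; apply: eq_bigl => i; lia.
Qed.

(** The valuation at p of f(1) ... f(N), by summation over the residue classes
    modulo p^(e+1).  For e = 0 the cardinal is the number of roots of f modulo
    p. *)
Lemma sum_logn_bound (f u v : {poly int}) (D : int) (p N V e : nat) :
  prime p -> D != 0 -> u * f + v * f^`() = D%:P ->
  (forall n, (0 < n <= N)%N -> f.[n%:Z] != 0) ->
  (forall n, (0 < n <= N)%N -> (logn p `|f.[n%:Z]| <= V)%N) ->
  e = logn p `|D| ->
  (\sum_(1 <= n < N.+1) logn p `|f.[n%:Z]| <=
   N * e + #|[pred t : 'I_(p ^ e.+1) | (p%:Z %| f.[(t : nat)%:Z])%Z]| * (logn p N`! + V))%N.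
Proof.
move=> pp D0 E f0 fV eE.
have q0 : (0 < p ^ e.+1)%N by rewrite expn_gt0 prime_gt0.
pose cl n : 'I_(p ^ e.+1) := Ordinal (ltn_pmod n q0).
have part (F : nat -> nat) : (\sum_(1 <= n < N.+1) F n =
    \sum_(t : 'I_(p ^ e.+1)) \sum_(1 <= n < N.+1 | n %% p ^ e.+1 == t) F n)%N.
  rewrite (partition_big cl predT) //=; apply: eq_bigr => t _; exact: eq_bigl.
have -> : (N * e = \sum_(1 <= n < N.+1) e)%N by rewrite sum_nat_const_nat subn1.
rewrite (part (fun _ => e)) part -sum1_card big_distrl /= [X in (_ + X)%N]big_mkcond -big_split /=.
apply: leq_sum => t _; case: ifP => ft.
  by rewrite mul1n; exact: (class_sum_bound t pp D0 E f0 fV eE).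
rewrite addn0 big1 // => n /eqP nt; apply/eqP; rewrite -leqn0 leqNgt logn_gt0 mem_primes.
apply/negP => /and3P[_ _ pn]; move/negP: ft; apply; rewrite inE.
have : (p%:Z %| f.[n%:Z])%Z by rewrite dvdzE.
rewrite -!Fp_intr_eq0 // -!Fp_horner; congr ((_).[_] == 0); apply/eqP.
rewrite -subr_eq0 -intrB Fp_intr_eq0 //.
apply: (@dvdz_trans (p ^ e.+1)%N%:Z); first by rewrite dvdzE /= dvdn_exp.
by rewrite -eqz_mod_dvd !modz_nat -nt modn_mod.
Qed.

Lemma horner_bound (f : {poly int}) (d n : nat) : (size f <= d.+1)%N -> (0 < n)%N ->
  (`|f.[n%:Z]| <= (\sum_(i < d.+1) `|(f`_i)%R|) * n ^ d)%N.
Proof.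
move=> sf n0; rewrite -lez_nat abszE (horner_coef_wide _ sf).
apply: le_trans (ler_norm_sum _ _ _) _.
rewrite big_distrl /= (big_morph Posz PoszD (erefl _)); apply: ler_sum => i _.
rewrite normrM PoszM abszE ler_wpM2l // ger0_norm ?exprn_ge0 //.
rewrite -[n%:Z]natz -natrX natz lez_nat leq_pexp2l //.
by rewrite -ltnS ltn_ord.
Qed.

(** An irreducible polynomial of degree at least 2 has no integer root. *)
Lemma irredp_horner_neq0 n (f : {poly int}) (x : int) :
  irreducible_poly f -> size f = n.+3 -> f.[x] != 0.
Proof.
move=> [_ firr] sf; apply/negP => fx.
have : 'X - x%:P %| f by rewrite dvdp_XsubCl.
by move/firr; rewrite size_XsubC => /(_ isT) /eqp_size; rewrite size_XsubC sf.
Qed.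

(** * Contribution of the small primes *)

Lemma trunc_log_ln_le (R : realType) (p m : nat) : (1 < p)%N -> (0 < m)%N ->
  (trunc_log p m)%:R * ln p%:R <= ln m%:R :> R.
Proof.
move=> p1 m0; rewrite -ln_natrX; apply: le_ln_natr; exact: trunc_logP.
Qed.

(** The contribution of a prime which divides neither D nor the leading
    coefficient of f. *)
Lemma good_prime_bound (R : realType) n (f u v : {poly int}) (D : int) (p N m : nat) :
  size f = n.+2 -> D != 0 -> u * f + v * f^`() = D%:P ->
  (forall k, (0 < k <= N)%N -> f.[k%:Z] != 0) ->
  (forall k, (0 < k <= N)%N -> (`|f.[k%:Z]| <= m)%N) -> (0 < m)%N ->
  prime p -> ~~ (p%:Z %| D)%Z -> ~~ (p%:Z %| lead_coef f)%Z ->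
  (\sum_(1 <= k < N.+1) logn p `|f.[k%:Z]|)%N%:R * ln p%:R <=
  N%:R * ((nroots f p)%:R * ln p%:R / (p%:R - 1)) + n.+1%:R * ln m%:R :> R.
Proof.
move=> sf D0 E f0 fm m0 pp pD pc.
have p1 := prime_gt1 pp.
have fV k : (0 < k <= N)%N -> (logn p `|f.[k%:Z]| <= trunc_log p m)%N.
  move=> kN; apply: trunc_log_max => //; apply: leq_trans (fm k kN).
  by apply: dvdn_leq; [rewrite absz_gt0 f0 | exact: pfactor_dvdnn].
have e0 : logn p `|D| = 0%N.
  apply/eqP; rewrite -leqn0 leqNgt logn_gt0 mem_primes; apply/negP => /and3P[_ _ pD'].
  by rewrite dvdzE pD' in pD.
have := sum_logn_bound pp D0 E f0 fV (esym e0).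
rewrite muln0 add0n expn1 -/(nroots f p) => H.
have lp : 0 <= ln p%:R :> R by exact: ln_natr_ge0.
have HR : (\sum_(1 <= k < N.+1) logn p `|f.[k%:Z]|)%N%:R <=
   (nroots f p)%:R * ((logn p N`!)%:R + (trunc_log p m)%:R) :> R.
  by rewrite -natrD -natrM ler_nat.
apply: (le_trans (ler_wpM2r lp HR)).
rewrite mulrDr mulrDl; apply: lerD.
  have p10 : 0 < p%:R - 1 :> R by rewrite subr_gt0 ltr1n.
  rewrite [leRHS]mulrCA -!mulrA ler_wpM2l //.
  rewrite [leLHS]mulrC ler_wpM2l // ler_pdivlMr //.
  have -> : p%:R - 1 = p.-1%:R :> R by rewrite -subn1 natrB // ltnW.
  by rewrite -natrM ler_nat logn_fact_le.
rewrite -mulrA; apply: ler_pM => //; first by rewrite mulr_ge0.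
  by rewrite ler_nat; have := nroots_le pp pc; rewrite sf.
exact: trunc_log_ln_le.
Qed.

(** A bound valid for every prime, but with a constant which depends on it. *)
Lemma bad_prime_bound (R : realType) (f u v : {poly int}) (D : int) (p : nat) :
  D != 0 -> u * f + v * f^`() = D%:P -> prime p ->
  exists B : R, 0 <= B /\ forall N m : nat,
  (forall k, (0 < k <= N)%N -> f.[k%:Z] != 0) ->
  (forall k, (0 < k <= N)%N -> (`|f.[k%:Z]| <= m)%N) -> (0 < m)%N ->
  (\sum_(1 <= k < N.+1) logn p `|f.[k%:Z]|)%N%:R * ln p%:R <= B * (N%:R + ln m%:R).
Proof.
move=> D0 E pp.
have p1 := prime_gt1 pp.
pose e := logn p `|D|.
have lp : 0 <= ln p%:R :> R by exact: ln_natr_ge0.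
exists ((e%:R + (p ^ e.+1)%N%:R) * ln p%:R + (p ^ e.+1)%N%:R).
split; first by rewrite addr_ge0 // mulr_ge0 // addr_ge0.
move=> N m f0 fm m0.
have fV k : (0 < k <= N)%N -> (logn p `|f.[k%:Z]| <= trunc_log p m)%N.
  move=> kN; apply: trunc_log_max => //; apply: leq_trans (fm k kN).
  by apply: dvdn_leq; [rewrite absz_gt0 f0 | exact: pfactor_dvdnn].
have H := sum_logn_bound pp D0 E f0 fV erefl; rewrite -/e in H.
have lN : (logn p N`! <= N)%N.
  apply: leq_trans (logn_fact_le N pp); rewrite leq_pmulr //; lia.
have {}H : (\sum_(1 <= k < N.+1) logn p `|f.[k%:Z]| <= N * e + p ^ e.+1 * (N + trunc_log p m))%N.
  apply: leq_trans H _; rewrite leq_add2l leq_mul ?leq_add2r //.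
  by apply: leq_trans (max_card _) _; rewrite card_ord.
move: H; rewrite -(ler_nat R) natrD !natrM natrD => H.
apply: (le_trans (ler_wpM2r lp H)).
have := trunc_log_ln_le R p1 m0; have := ln_natr_ge0 R m.
set T := (trunc_log p m)%:R; set q := (p ^ e.+1)%N%:R; set L := ln m%:R; set l := ln p%:R in lp *.
move=> L0 TL.
have q0 : 0 <= q :> R by rewrite ler0n.
have e0 : 0 <= e%:R :> R by rewrite ler0n.
have N0 : 0 <= N%:R :> R by rewrite ler0n.
have h1 : q * (T * l) <= q * L by rewrite ler_wpM2l.
have h2 : 0 <= (e%:R + q) * l * L by rewrite !mulr_ge0 // addr_ge0.
have h3 : 0 <= q * N%:R by rewrite mulr_ge0.
clear - h1 h2 h3.
lra.
Qed.

(** [bad_prime_bound] with a constant chosen for every p at once. *)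
Lemma bad_primes_bound (R : realType) (f u v : {poly int}) (D : int) :
  D != 0 -> u * f + v * f^`() = D%:P ->
  exists B : nat -> R, forall p, 0 <= B p /\ (prime p -> forall N m : nat,
  (forall k, (0 < k <= N)%N -> f.[k%:Z] != 0) ->
  (forall k, (0 < k <= N)%N -> (`|f.[k%:Z]| <= m)%N) -> (0 < m)%N ->
  (\sum_(1 <= k < N.+1) logn p `|f.[k%:Z]|)%N%:R * ln p%:R <= B p * (N%:R + ln m%:R)).
Proof.
move=> D0 E.
suff H p : exists B : R, 0 <= B /\ (prime p -> forall N m : nat,
  (forall k, (0 < k <= N)%N -> f.[k%:Z] != 0) ->
  (forall k, (0 < k <= N)%N -> (`|f.[k%:Z]| <= m)%N) -> (0 < m)%N ->
  (\sum_(1 <= k < N.+1) logn p `|f.[k%:Z]|)%N%:R * ln p%:R <= B * (N%:R + ln m%:R)).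
  by have [B HB] := choice H; exists B.
have [pp|pp] := boolP (prime p); last by exists 0; split.
by have [B [B0 HB]] := bad_prime_bound R D0 E pp; exists B; split.
Qed.

Lemma sum_cond_le (R : realType) (B : nat -> R) (X Y : nat) : (forall p, 0 <= B p) ->
  \sum_(0 <= p < X | prime p) (if (p <= Y)%N then B p else 0) <= \sum_(0 <= p < Y.+1) B p.
Proof.
move=> B0; rewrite -big_mkcondr.
apply: (@le_trans _ _ (\sum_(0 <= p < maxn X Y.+1 | prime p && (p <= Y)%N) B p)).
  by apply: ler_sum_nat_widen => //; rewrite leq_maxl.
rewrite (big_cat_nat (n := Y.+1)) //=; last by rewrite leq_maxr.
rewrite [X in _ + X]big_nat_cond [X in _ + X]big_pred0 ?addr0; last first.
  by move=> p; apply/negP; lia.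
by rewrite big_mkcond; apply: ler_sum => p _; case: ifP.
Qed.

Lemma small_primes_bound (R : realType) n (f : {poly int}) (K : nat) (eps : R) :
  irreducible_poly f -> size f = n.+3 -> (0 < K)%N -> 0 < eps ->
  exists C : R, forall N : nat, (0 < N)%N ->
  \sum_(0 <= p < (K * N).+1 | prime p)
     (\sum_(1 <= k < N.+1) logn p `|f.[k%:Z]|)%N%:R * ln p%:R <=
  (1 + eps) * (N%:R * ln N%:R) + C * N%:R.
Proof.
move=> firr sf K0 eps0.
have [u [v [D [D0 E]]]] := irredp_deriv_bezout firr sf.
have [B HB] := bad_primes_bound R D0 E.
have f0 : f != 0 by rewrite -size_poly_gt0 sf.
have c0 : lead_coef f != 0 by rewrite lead_coef_eq0.
(* So that (1 + e1) ^ 2 <= 1 + eps / 2. *)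
pose e1 := Num.min 1 (eps / 6).
have e10 : 0 < e1 by rewrite lt_min ltr01 divr_gt0.
have e11 : e1 <= 1 by rewrite ge_min lexx.
have e1e : e1 <= eps / 6 by rewrite ge_min lexx orbT.
have [P0 HP0] := exists_nat_ge ((1 + e1) / e1).
pose P1 := (P0 + `|D| + `|lead_coef f|)%N.
have [C1 HC1] := root_sum_le firr sf e10.
pose d : R := n.+2%:R.
have d0 : 0 < d by rewrite ltr0n.
have KR : 0 < K%:R :> R by rewrite ltr0n.
pose delta := eps / (2 * d ^+ 2 * K%:R).
have del0 : 0 < delta by rewrite divr_gt0 // !mulr_gt0 // exprn_gt0.
have [C2 [C20 HC2]] := prime_count_small del0.
pose A := (\sum_(i < n.+3) `|(f`_i)%R|).+1%N.
pose a : R := ln A%:R.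
have a0 : 0 <= a by exact: ln_natr_ge0.
pose C3 := \sum_(0 <= p < P1.+1) B p.
have C30 : 0 <= C3 by apply: sumr_ge0 => p _; have [] := HB p.
pose C := (1 + e1) * ((1 + e1) * ln K%:R + C1) + d * a * (delta * K%:R + C2)
   + d ^+ 2 * C2 + C3 * (1 + a + d).
exists C => N N0.
have N0R : 0 < N%:R :> R by rewrite ltr0n.
pose m := (A * N ^ n.+2)%N.
have m0 : (0 < m)%N by rewrite muln_gt0 expn_gt0 N0.
pose x : R := ln N%:R.
have x0 : 0 <= x by exact: ln_natr_ge0.
have xN : x <= N%:R by exact: ln_natr_le.
have Lm : ln m%:R = a + d * x by rewrite ln_natrM ?expn_gt0 ?N0 // ln_natrX.
have fk0 k : (0 < k <= N)%N -> f.[k%:Z] != 0 by move=> _; exact: irredp_horner_neq0 sf.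
have fkm k : (0 < k <= N)%N -> (`|f.[k%:Z]| <= m)%N.
  move=> /andP[k0 kN]; apply: leq_trans (@horner_bound f n.+2 k _ k0) _; first by rewrite sf.
  by rewrite leq_mul ?leqnSn // leq_exp2r.
have term p : prime p ->
  (\sum_(1 <= k < N.+1) logn p `|f.[k%:Z]|)%N%:R * ln p%:R <=
   N%:R * (1 + e1) * ((nroots f p)%:R * ln p%:R / p%:R) + d * ln m%:R
   + (if (p <= P1)%N then B p else 0) * (N%:R + ln m%:R) :> R.
  move=> pp; have lp : 0 <= ln p%:R :> R by exact: ln_natr_ge0.
  have p0 : 0 < p%:R :> R by rewrite ltr0n prime_gt0.
  have t0 : 0 <= (nroots f p)%:R * ln p%:R / p%:R :> R by rewrite divr_ge0 ?mulr_ge0.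
  (* Every prime p <= P1 is treated as bad; this includes those which divide D or the
     leading coefficient, and those with p / (p - 1) > 1 + e1. *)
  case: leqP => pP.
    apply: (le_trans ((HB p).2 pp N m fk0 fkm m0)); rewrite lerDr addr_ge0 //.
      by rewrite !mulr_ge0 // addr_ge0 // ltW.
    by rewrite mulr_ge0 // ?ln_natr_ge0 // ltW.
  have pD : ~~ (p%:Z %| D)%Z.
    rewrite dvdzE; apply/negP => /dvdn_leq; rewrite absz_gt0 D0 => /(_ isT) /=.
    by move: pP; rewrite /P1; clear; lia.
  have pc : ~~ (p%:Z %| lead_coef f)%Z.
    rewrite dvdzE; apply/negP => /dvdn_leq; rewrite absz_gt0 c0 => /(_ isT) /=.
    by move: pP; rewrite /P1; clear; lia.
  apply: (le_trans (good_prime_bound R sf D0 E fk0 fkm m0 pp pD pc)).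
  rewrite mul0r addr0 lerD2r -[leRHS]mulrA ler_wpM2l //.
  have p1 : 0 < p%:R - 1 :> R by rewrite subr_gt0 ltr1n prime_gt1.
  have pe : 1 + e1 <= e1 * p%:R.
    rewrite [leRHS]mulrC -ler_pdivrMr //; apply: le_trans HP0 _; rewrite ler_nat.
    by move: pP; rewrite /P1; clear; lia.
  rewrite ler_pdivrMr //.
  have tE : (nroots f p)%:R * ln p%:R = (nroots f p)%:R * ln p%:R / p%:R * p%:R :> R.
    by rewrite divfK // lt0r_neq0.
  rewrite {1}tE; set y := _ / p%:R in t0 *.
  have : y * (1 + e1) <= y * (e1 * p%:R) by rewrite ler_wpM2l.
  by clear; lra.
apply: (@le_trans _ _ (N%:R * (1 + e1) * root_sum R f (K * N)
   + (prime_count (K * N))%:R * (d * ln m%:R)  + C3 * (N%:R + ln m%:R))).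
  apply: le_trans; [by apply: ler_sum => p pp; exact: (term p pp)|].
  rewrite !big_split /= -mulr_sumr; apply: lerD.
    by rewrite lerD2l /prime_count natr_sum mulr_suml; apply: ler_sum => p _; rewrite mul1r.
  rewrite -mulr_suml ler_wpM2r ?addr_ge0 ?ln_natr_ge0 //; apply: sum_cond_le => p.
  by have [] := HB p.
have KN0 : (0 < K * N)%N by rewrite muln_gt0 K0.
have H1 := HC1 _ KN0; have H2 := HC2 (K * N)%N.
have lnKN : ln (K * N)%N%:R = ln K%:R + x :> R by rewrite ln_natrM.
rewrite lnKN in H1; rewrite natrM in H2.
have L0 : 0 <= ln m%:R :> R by exact: ln_natr_ge0.
have G1 : N%:R * (1 + e1) * root_sum R f (K * N) <=
   N%:R * (1 + e1) * ((1 + e1) * (ln K%:R + x) + C1).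
  by rewrite ler_wpM2l // mulr_ge0 // addr_ge0 // ltW.
have G2 : (prime_count (K * N))%:R * (d * ln m%:R) <=
   (delta * (K%:R * N%:R) + C2) * (d * ln m%:R).
  by rewrite ler_wpM2r // mulr_ge0 // ltW.
apply: (le_trans (lerD (lerD G1 G2) (lexx _))).
rewrite Lm -/x.
have E1 : (1 + e1) * (1 + e1) <= 1 + eps / 2.
  have : e1 * e1 <= e1 * 1 by rewrite ler_wpM2l // ltW.
  by move: e1e; clear; lra.
have G3 : N%:R * x * ((1 + e1) * (1 + e1)) <= N%:R * x * (1 + eps / 2).
  by rewrite ler_wpM2l // mulr_ge0.
have dE : delta * K%:R * d * d = eps / 2.
  rewrite /delta; field; rewrite !lt0r_neq0 //.
have G4 : (delta * (K%:R * N%:R)) * (d * (d * x)) = eps / 2 * (N%:R * x).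
  by rewrite -dE; ring.
have N1 : 1 <= N%:R :> R by rewrite ler1n.
have G5 : C2 * (d * a) * 1 <= C2 * (d * a) * N%:R.
  by rewrite ler_wpM2l // !mulr_ge0 // ltW.
have G6 : C2 * d * d * x <= C2 * d * d * N%:R.
  by rewrite ler_wpM2l // !mulr_ge0 // ltW.
have G7 : C3 * a * 1 <= C3 * a * N%:R by rewrite ler_wpM2l // !mulr_ge0.
have G8 : C3 * d * x <= C3 * d * N%:R by rewrite ler_wpM2l // !mulr_ge0 // ltW.
rewrite /C; move: (ln K%:R) G3 G4 G5 G6 G7 G8; clear => k G3 G4 G5 G6 G7 G8.
lra.
Qed.

(** * Roots modulo large primes *)

Lemma Fp_nat_inj (p N : nat) (a b : nat) : prime p -> (N < p)%N -> (a <= N)%N -> (b <= N)%N ->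
  a%:R = b%:R :> 'F_p -> a = b.
Proof.
move=> pp Np aN bN /(congr1 val); rewrite /= !val_Fp_nat // !modn_small //; lia.
Qed.

(** The sum of the roots of h - y modulo p, when h - y has as many roots as its
    degree.  The constant y does not affect the coefficient of degree s - 1,
    because s >= 2. *)
Lemma fiber_vieta (h : {poly int}) (s p N : nat) (y : 'F_p) (S : seq nat) :
  size h = s.+1 -> (2 <= s)%N -> prime p -> (N < p)%N -> ~~ (p%:Z %| lead_coef h)%Z ->
  uniq S -> size S = s -> (forall n, n \in S -> (n <= N)%N /\ (h.[n%:Z])%:~R = y) ->
  (p%:Z %| (lead_coef h * (\sum_(n <- S) n)%N%:Z + h`_s.-1)%R)%Z.
Proof.
move=> sh s2 pp Np pc uS sS HS.
pose hp : {poly 'F_p} := map_poly (intr : int -> 'F_p) h - y%:P.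
have lc0 : (lead_coef h)%:~R != 0 :> 'F_p by rewrite Fp_intr_eq0.
have shp0 : size (map_poly (intr : int -> 'F_p) h) = s.+1 by rewrite size_map_poly_id0.
have sy : (size (y%:P)%R < s.+1)%N by rewrite size_polyC; case: (y != 0) => /=; lia.
have shp : size hp = s.+1 by rewrite /hp size_polyDl ?size_polyN shp0.
have lhp : lead_coef hp = (lead_coef h)%:~R.
  by rewrite /hp lead_coefDl ?size_polyN ?shp0 // lead_coef_map_id0.
pose rs := [seq (n%:R : 'F_p) | n <- S].
have urs : uniq rs.
  rewrite map_inj_in_uniq // => a b aS bS ab.
  by apply: (Fp_nat_inj pp Np _ _ ab); [have [] := HS _ aS | have [] := HS _ bS].
have rrs : all (root hp) rs.
  apply/allP => z /mapP[n nS ->]; rewrite /root /hp hornerD hornerN hornerC.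
  by have [_ <-] := HS _ nS; rewrite -Fp_horner -pmulrn subrr.
have srs : size hp = (size rs).+1 by rewrite shp size_map sS.
have := all_roots_prod_XsubC srs rrs; rewrite uniq_rootsE => /(_ urs).
move=> /(congr1 (fun q : {poly 'F_p} => q`_s.-1)).
have <- : size rs = s by rewrite size_map.
rewrite coefZ coefPn_prod_XsubC; last by rewrite size_map sS; lia.
rewrite size_map sS /hp coefB coef_map /= coefC.
have -> : (s.-1 == 0)%N = false by lia.
rewrite subr0 -/hp lhp => H.
rewrite -Fp_intr_eq0 // intrD intrM H /rs big_map.
rewrite -pmulrn natr_sum mulrN subrr //.
Qed.

(** At most r fibres of h modulo p, each with at most s - 1 elements of [1, N]. *)
Lemma large_prime_roots (g h : {poly int}) (r s : nat) :
  size g = r.+1 -> size h = s.+1 -> (2 <= s)%N ->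
  (forall x : int, (g \Po h).[x] != 0) ->
  exists K : nat, (0 < K)%N /\ forall N p : nat, (0 < N)%N -> prime p -> (K * N < p)%N ->
  (#|[pred n : 'I_N.+1 | (0 < n)%N && (p%:Z %| (g \Po h).[(n : nat)%:Z])%Z]| <= r * s.-1)%N.
Proof.
move=> sg sh s2 f0.
set f := g \Po h in f0 *.
pose b := `|(h`_s.-1)%R|%N.
pose M := (\sum_(n < b.+1) `|f.[(n : nat)%:Z]|)%N.
(* K N exceeds the leading coefficients, the integer given by the sum of the
   roots, and the values of f at the integers up to b. *)
pose K := (`|lead_coef g| + `|lead_coef h| * s + b + M).+1.
exists K; split => // N p N0 pp KNp.
have KN : (K <= K * N)%N by rewrite leq_pmulr.
have NK : (N <= K * N)%N by rewrite leq_pmull.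
have Np : (N < p)%N by apply: leq_ltn_trans KNp.
have gcoef (c : int) : c != 0 -> (`|c| < p)%N -> ~~ (p%:Z %| c)%Z.
  move=> c0 cp; rewrite dvdzE; apply/negP => /dvdn_leq; rewrite absz_gt0 c0 => /(_ isT) /=; lia.
have pg : ~~ (p%:Z %| lead_coef g)%Z.
  by apply: gcoef; [rewrite lead_coef_eq0 -size_poly_gt0 sg | move: KNp KN; rewrite /K; clear; lia].
have lh0 : lead_coef h != 0 by rewrite lead_coef_eq0 -size_poly_gt0 sh.
have ph : ~~ (p%:Z %| lead_coef h)%Z.
  apply: gcoef => //; apply: leq_ltn_trans KNp; apply: leq_trans KN.
  by apply: (@leq_trans (`|lead_coef h| * s)); [rewrite leq_pmulr //; lia | rewrite /K; lia].
set A := [pred n : 'I_N.+1 | _].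
pose phi (n : 'I_N.+1) : 'F_p := (h.[(n : nat)%:Z])%:~R.
pose gp := map_poly (intr : int -> 'F_p) g.
have sgp : size gp = r.+1.
  by rewrite size_map_poly_id0 // Fp_intr_eq0.
have gp0 : gp != 0 by rewrite -size_poly_gt0 sgp.
have fib y : (#|[pred n in A | phi n == y]| <= s.-1)%N.
  rewrite leqNgt; apply/negP => big.
  set T := [pred n in A | _] in big.
  pose S := map (@nat_of_ord N.+1) (take s (enum T)).
  have s0 : (0 < s)%N by exact: ltnW.
  have szS : size S = s by rewrite size_map size_takel // -cardE -(prednK s0).
  have uS : uniq S by rewrite map_inj_uniq ?take_uniq ?enum_uniq //; exact: ord_inj.
  have HT n : n \in S -> exists2 i : 'I_N.+1, i \in T & n = nat_of_ord i.
    by move=> /mapP[i /mem_take]; rewrite mem_enum => iT ->; exists i.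
  have HS n : n \in S -> (n <= N)%N /\ (h.[n%:Z])%:~R = y.
    move=> /HT[i iT ->]; split; first by rewrite -ltnS.
    by move: iT; rewrite !inE => /andP[_ /eqP].
  have sumS : (\sum_(n <- S) n <= s * N)%N.
    rewrite -szS -sum1_size big_distrl /= big_seq [leqRHS]big_seq.
    by apply: leq_sum => n /HS[nN _]; rewrite mul1n.
  have := fiber_vieta sh s2 pp Np ph uS szS HS.
  set Z := _ + _.
  (* The integer Z is divisible by p and smaller than p, hence it is 0. *)
  have [Z0 _|Z0] := eqVneq Z 0; last first.
    apply/negP/gcoef => //.
    apply: leq_ltn_trans KNp.
    apply: (@leq_trans (`|lead_coef h| * (s * N) + b * N)); last first.
      by rewrite mulnA -mulnDl leq_mul2r /K; apply/orP; right; lia.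
    rewrite /Z; apply: (@leq_trans (`|(lead_coef h * (\sum_(n <- S) n)%N%:Z)%R| + b)).
      rewrite /b; lia.
    by rewrite abszM /= leq_add ?leq_mul // leq_pmulr.
  have S1 : (0 < size S)%N by rewrite szS; lia.
  (* An element of the fibre, bounded by b, at which f is too small to be
     divisible by p. *)
  pose n1 := nth 0%N S 0.
  have n1S : n1 \in S by rewrite mem_nth.
  have n1b : (n1 <= b)%N.
    apply: (@leq_trans (\sum_(n <- S) n)); first by rewrite (big_rem n1) //= leq_addr.
    have -> : b = (`|lead_coef h| * (\sum_(n <- S) n))%N.
      have -> : (\sum_(n <- S) n)%N = `|(\sum_(n <- S) n)%N%:Z|%N by [].
      rewrite -abszM /b; move: Z0; rewrite /Z; lia.
    by rewrite leq_pmull // absz_gt0.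
  have [i iT n1i] := HT _ n1S.
  have pf : (p%:Z %| f.[n1%:Z])%Z by rewrite n1i; move: iT; rewrite !inE => /andP[/andP[]].
  move: pf; apply/negP/gcoef => //.
  have : (`|f.[n1%:Z]| <= M)%N.
    have n1b' : (n1 < b.+1)%N by [].
    by rewrite /M (bigD1 (Ordinal n1b')) //= leq_addr.
  move: KNp KN; rewrite /K; clear; lia.
have gA n : n \in A -> root gp (phi n).
  rewrite inE => /andP[_]; rewrite /f horner_comp -Fp_intr_eq0 // -Fp_horner.
  by rewrite /root /gp.
have rootr : (#|[pred y : 'F_p | root gp y]| <= r)%N.
  rewrite -ltnS -sgp cardE; apply: (@max_poly_roots 'F_p) => //; last exact: enum_uniq.
  by apply/allP => y; rewrite mem_enum.
apply: (@leq_trans (\sum_(y | root gp y) #|[pred n in A | phi n == y]|)).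
  rewrite -sum1_card (partition_big phi (fun y => root gp y)) => [|n /gA //].
  by apply: leq_sum => y _; rewrite -sum1_card leq_eqVlt; apply/orP; left; apply/eqP; apply: eq_bigl.
apply: (@leq_trans (\sum_(y | root gp y) s.-1)); first by apply: leq_sum.
by rewrite sum_nat_const leq_mul2r rootr orbT.
Qed.

(** * The lower bound for the least common multiple *)

(** A lower bound of order k^(n+1) for |f(k)|, valid for all k > 0. *)
Lemma horner_lower n (f : {poly int}) : size f = n.+2 -> (forall k : nat, f.[k%:Z] != 0) ->
  exists A : nat, (0 < A)%N /\ forall k : nat, (0 < k)%N -> (k ^ n.+1 <= A * `|f.[k%:Z]|)%N.
Proof.
move=> sf f0.
pose B := (\sum_(i < n.+1) `|(f`_i)%R|)%N.
exists ((2 * B) ^ n.+1 + 2)%N; split; first by rewrite addn2.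
move=> k k0.
have fk0 : (0 < `|f.[k%:Z]|)%N by rewrite absz_gt0.
(* For k <= 2 B it suffices that |f(k)| >= 1; for larger k the leading term
   dominates. *)
have [kB|kB] := leqP k (2 * B).
  apply: (@leq_trans ((2 * B) ^ n.+1 * 1)); first by rewrite muln1 leq_exp2r.
  by rewrite leq_mul // leq_addr.
apply: (@leq_trans (2 * `|f.[k%:Z]|)); last by rewrite leq_mul2r leq_addl orbT.
pose low := \sum_(i < n.+1) f`_i * k%:Z ^+ i.
have E : f.[k%:Z] = low + lead_coef f * k%:Z ^+ n.+1.
  by rewrite horner_coef sf big_ord_recr /= lead_coefE sf.
have lowB : (`|low| <= B * k ^ n)%N.
  pose q : {poly int} := \poly_(i < n.+1) f`_i.
  have -> : low = q.[k%:Z].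
    by rewrite horner_poly.
  apply: leq_trans (@horner_bound q n k (size_poly _ _) k0) _.
  rewrite leq_mul2r /B; apply/orP; right; apply: leq_sum => i _.
  by rewrite coef_poly ltn_ord.
have lead1 : (k ^ n.+1 <= `|(lead_coef f * k%:Z ^+ n.+1)%R|)%N.
  by rewrite abszM abszX leq_pmull // absz_gt0 lead_coef_eq0 -size_poly_gt0 sf.
have tri : (`|(lead_coef f * k%:Z ^+ n.+1)%R| <= `|f.[k%:Z]| + `|low|)%N.
  by rewrite E; clear; lia.
have kk : (2 * (B * k ^ n) <= k ^ n.+1)%N.
  by rewrite mulnA expnS leq_mul2r ltnW ?orbT.
by move: lowB lead1 tri kk; clear; lia.
Qed.

Lemma sum_ln_ge (R : realType) (N : nat) :
  N%:R * ln N%:R - N%:R <= \sum_(1 <= k < N.+1) ln k%:R :> R.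
Proof.
elim: N => [|N IH]; first by rewrite big_geq // mul0r subr0.
rewrite big_nat_recr //=; apply: (le_trans _ (lerD IH (lexx _))).
case: N {IH} => [|N]; first by rewrite ln1 mul0r mulr0; lra.
set a : R := N.+1%:R.
have a0 : 0 < a by rewrite ltr0n.
have -> : N.+2%:R = a + 1 :> R by rewrite natr1.
have H : ln (a + 1) <= ln a + a^-1.
  have -> : a + 1 = a * (1 + a^-1) by rewrite mulrDr mulr1 divff // lt0r_neq0.
  have i0 : 0 < a^-1 by rewrite invr_gt0.
  rewrite lnM ?posrE ?addr_gt0 // lerD2l.
  by apply: le_ln1Dx; apply: lt_trans i0; rewrite ltrN10.
have : a * ln (a + 1) <= a * (ln a + a^-1) by rewrite ler_wpM2l // ltW.
rewrite mulrDr divff ?lt0r_neq0 //; lra.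
Qed.

Lemma sum_ln_horner_ge (R : realType) n (f : {poly int}) :
  size f = n.+2 -> (forall k : nat, f.[k%:Z] != 0) ->
  exists C : R, forall N : nat,
   n.+1%:R * (N%:R * ln N%:R) - C * N%:R <= \sum_(1 <= k < N.+1) ln `|f.[k%:Z]|%N%:R.
Proof.
move=> sf f0; have [A [A0 HA]] := horner_lower sf f0.
exists (n.+1%:R + ln A%:R) => N.
have H : \sum_(1 <= k < N.+1) (n.+1%:R * ln k%:R - ln A%:R) <=
    \sum_(1 <= k < N.+1) ln `|f.[k%:Z]|%N%:R :> R.
  rewrite big_nat_cond [leRHS]big_nat_cond; apply: ler_sum => k /andP[/andP[k0 _] _].
  rewrite lerBlDl -ln_natrM ?absz_gt0 // -ln_natrX; apply: le_ln_natr; exact: HA.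
apply: le_trans H; rewrite sumrB -mulr_sumr sumr_const_nat subn1 /= -[ln A%:R *+ N]mulr_natr.
have := ler_wpM2l (ler0n R n.+1) (sum_ln_ge R N).
lra.
Qed.

Lemma poly_lcm_gt0 (f : {poly int}) (N : nat) : (forall k : nat, f.[k%:Z] != 0) ->
  (0 < poly_lcm f N)%N.
Proof.
move=> f0; elim: N => [|N IH]; first by rewrite /poly_lcm big_geq.
by rewrite /poly_lcm big_nat_recr //= lcmn_gt0 IH absz_gt0 f0.
Qed.

Lemma dvdn_poly_lcm (f : {poly int}) (N k : nat) : (0 < k <= N)%N ->
  (`|f.[k%:Z]| %| poly_lcm f N)%N.
Proof.
elim: N => [|N IH] kN; first by lia.
rewrite /poly_lcm big_nat_recr //=.
have [->|kN'] := eqVneq k N.+1; first exact: dvdn_lcmr.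
by apply: dvdn_trans (dvdn_lcml _ _); apply: IH; lia.
Qed.

(** If p divides at most c of the f(n) with 1 <= n <= N, then the valuation of
    their product is at most c times that of their least common multiple. *)
Lemma logn_prod_le (f : {poly int}) (p N c : nat) : (forall k : nat, f.[k%:Z] != 0) ->
  (#|[pred n : 'I_N.+1 | (0 < n)%N && (p%:Z %| f.[(n : nat)%:Z])%Z]| <= c)%N ->
  (\sum_(1 <= k < N.+1) logn p `|f.[k%:Z]| <= c * logn p (poly_lcm f N))%N.
Proof.
move=> f0 Hc; apply: leq_trans (leq_mul Hc (leqnn _)).
rewrite -sum1_card big_distrl /=.
rewrite (_ : \sum_(1 <= k < N.+1) _ = \sum_(0 <= k < N.+1 | (0 < k)%N) logn p `|f.[k%:Z]|)%N.
  rewrite big_mkord [leqLHS]big_mkcond [leqRHS]big_mkcond; apply: leq_sum => i _ /=.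
  rewrite inE; case: ifP => //= i0.
  case: ifP => pf.
    by rewrite mul1n dvdn_leq_log ?poly_lcm_gt0 // dvdn_poly_lcm // i0 -ltnS ltn_ord.
  by rewrite leqNgt logn_gt0 mem_primes; rewrite dvdzE in pf; rewrite pf !andbF.
rewrite [RHS]big_ltn_cond //= big_nat_cond [RHS]big_nat_cond.
by apply: eq_bigl => i; lia.
Qed.

Lemma le_limn_einf (R : realType) (u : nat -> R) (l : R) :
  (forall e, 0 < e -> exists N0 : nat, forall N, (N0 <= N)%N -> l - e <= u N) ->
  (l%:E <= limn_einf (fun N => (u N)%:E))%E.
Proof.
move=> H; apply/lee_subgt0Pr => e e0; have [N0 HN0] := H e e0.
rewrite limn_einf_lim; apply: lime_ge; first exact: is_cvg_einfs.
exists N0 => // m /= N0m.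
apply: le_ereal_inf_tmp => _ [k /= mk <-].
by rewrite -EFinB lee_fin HN0 // (leq_trans N0m).
Qed.

(** The lower bound with an explicit error term; here d = n + 2 and
    d - r = r (s - 1). *)
Lemma log_lcm_comp_ge (R : realType) (g h : {poly int}) (n r s : nat) (eps : R) :
  irreducible_poly (g \Po h) -> size g = r.+1 -> size h = s.+1 ->
  size (g \Po h) = n.+3 -> (2 <= s)%N -> 0 < eps ->
  exists C : R, forall N : nat, (0 < N)%N ->
    (n.+1%:R - eps) * (N%:R * ln N%:R) - C * N%:R <=
      (r * s.-1)%N%:R * ln (poly_lcm (g \Po h) N)%:R.
Proof.
move=> firr sg sh sf s2 eps0.
set f := g \Po h in firr sf *.
have f0 (x : int) : f.[x] != 0 by exact: irredp_horner_neq0 sf.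
have f0' (k : nat) : f.[k%:Z] != 0 by [].
have [K [K0 HK]] := large_prime_roots sg sh s2 f0.
have [C1 HC1] := small_primes_bound firr sf K0 eps0.
have [C2 HC2] := sum_ln_horner_ge R sf f0'.
exists (C1 + C2) => N N0.
pose L := poly_lcm f N.
have L0 : (0 < L)%N by exact: poly_lcm_gt0.
pose X := (maxn (K * N) L).+1.
pose a p := (\sum_(1 <= k < N.+1) logn p `|f.[k%:Z]|)%N.
have E : \sum_(1 <= k < N.+1) ln `|f.[k%:Z]|%N%:R =
   \sum_(0 <= p < X | prime p) (a p)%:R * ln p%:R :> R.
  under [RHS]eq_bigr do rewrite /a natr_sum mulr_suml.
  rewrite exchange_big /= big_nat_cond [RHS]big_nat_cond.
  apply: eq_bigr => k /andP[/andP[k1 kN] _].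
  apply: ln_eq_sum_logn; first by rewrite absz_gt0.
  rewrite ltnS; apply: leq_trans (leq_maxr _ _).
  by apply: dvdn_leq => //; apply: dvdn_poly_lcm; rewrite k1.
have large : \sum_((K * N).+1 <= p < X | prime p) (a p)%:R * ln p%:R <=
   (r * s.-1)%N%:R * ln L%:R :> R.
  apply: (@le_trans _ _ (\sum_((K * N).+1 <= p < X | prime p)
      (r * s.-1)%N%:R * ((logn p L)%:R * ln p%:R))).
    rewrite [leLHS]big_nat_cond [leRHS]big_nat_cond.
    apply: ler_sum => p /andP[/andP[Kp _] pp].
    rewrite mulrA ler_wpM2r ?ln_natr_ge0 // -natrM ler_nat.
    by apply: logn_prod_le => //; exact: HK.
  rewrite -mulr_sumr ler_wpM2l //.
  apply: le_trans (sum_logn_le_ln R X L0).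
  rewrite [leRHS](big_cat_nat (n := (K * N).+1)) //=; last by rewrite ltnS leq_maxl.
  by rewrite lerDr sumr_ge0 // => p _; rewrite mulr_ge0 // ln_natr_ge0.
have := HC2 N; rewrite E (big_cat_nat (n := (K * N).+1)) //=; last by rewrite ltnS leq_maxl.
have := HC1 N N0; rewrite -/L; move: large.
have -> : n.+2%:R = n.+1%:R + 1 :> R by rewrite natr1.
rewrite -/(a _).
move: (\sum_(_ <= p < _ | prime p) _) => S1 H1.
move: (\sum_(_ <= p < _ | prime p) _) => S2 H2.
lra.
Qed.

Theorem corollary1p5 (R : realType) (f g h : {poly int}) (d r s : nat)
  (f_comp : f = g \Po h)
  (f_irr : irreducible_poly f)
  (deg_g : size g = r.+1)
  (deg_h : size h = s.+1)
  (deg_f : size f = d.+1)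
  (d_eq : d = (r * s)%N)
  (r_ge2 : (2 <= r)%N)
  (s_ge2 : (2 <= s)%N) :
  asymp_ge (fun N : nat => ln (poly_lcm f N)%:R : R)
           (fun N : nat => (d%:R - 1) / (d%:R - r%:R) * (N%:R * ln N%:R)).
Proof.
have d4 : (4 <= d)%N by rewrite d_eq (leq_mul r_ge2 s_ge2).
have rd : (r * s.-1 + r = d)%N by rewrite d_eq -mulnSr prednK // ltnW.
have d1N : (1 < d)%N by exact: leq_trans d4.
have dE : d.-2.+2 = d by move: d1N; clear; lia.
have deg_f' : size (g \Po h) = d.-2.+3 by rewrite -f_comp deg_f dE.
rewrite f_comp in f_irr *.
apply: le_limn_einf => e e0.
have d1 : 0 < d%:R - 1 :> R by rewrite subr_gt0 ltr1n.
have rs0 : (0 < r * s.-1)%N by rewrite muln_gt0 (ltnW r_ge2) -subn1 subn_gt0.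
have drE : d%:R - r%:R = (r * s.-1)%N%:R :> R by rewrite -{1}rd natrD addrK.
have dr : 0 < d%:R - r%:R :> R by rewrite drE ltr0n.
pose eps := e * (d%:R - 1) / 2.
have eps0 : 0 < eps by rewrite divr_gt0 // mulr_gt0.
have [C HC] := log_lcm_comp_ge f_irr deg_g deg_h deg_f' s_ge2 eps0.
have [N0 HN0] := exists_ln_ge (C / eps).
exists N0 => N /HN0[N1 CN].
have NR : 0 < N%:R :> R by rewrite ltr0n ltnW.
have xR : 0 < ln N%:R :> R by rewrite ln_gt0 // ltr1n.
have := HC N (ltnW N1).
rewrite -drE.
have -> : d.-2.+1%:R = d%:R - 1 :> R by rewrite -[in RHS]dE -[in RHS]natr1 addrK.
rewrite ler_pdivlMr; last by rewrite !mulr_gt0 // invr_gt0.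
have CN' : C <= eps * ln N%:R by rewrite [leRHS]mulrC -ler_pdivrMr.
move=> H.
rewrite -(ler_pM2l dr); apply: le_trans H.
set x := ln N%:R in xR CN' *.
have -> : (d%:R - r%:R) * ((1 - e) * ((d%:R - 1) / (d%:R - r%:R) * (N%:R * x))) =
   (1 - e) * (d%:R - 1) * (N%:R * x) by field; rewrite lt0r_neq0.
have : C * N%:R <= eps * x * N%:R by rewrite ler_pM2r.
rewrite /eps; move: NR xR; clear; move=> *; lra.
Qed.
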